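(* Let $N\ge 1$ and $J=(0,1)$. For every $\varepsilon\in J$, let $\rho_\varepsilon\colon \mathbb{R}^N\to[0,+\infty)$ be measurable, and let $$\mathscr{F}_\varepsilon[u]=\frac12\int_{\mathbb{R}^N\times\mathbb{R}^N}\rho_\varepsilon(y-x)\frac{|u(y)-u(x)|^2}{|y-x|^2}\,\mathrm{d}y\,\mathrm{d}x .$$ Let $\lambda$ be a fixed positive Radon measure on the unit sphere $\mathbb{S}^{N-1}$. Suppose that there exists a sequence $\{\varepsilon_k\}\subset J$ with $\varepsilon_k\to0$ such that for every $u\in H^1(\mathbb{R}^N)$ $$\lim_{k\to+\infty}\mathscr{F}_{\varepsilon_k}[u]=\int_{\mathbb{R}^N}\int_{\mathbb{S}^{N-1}}|\nabla u(x)\cdot\sigma|^2\,\mathrm{d}\lambda(\sigma)\,\mathrm{d}x .$$ Then the sequence $\{\rho_{\varepsilon_k}\}$ satisfies the following: (i) there exists $M\ge0$ such that for every $R>0$ $$\limsup_{k\to+\infty}\left[\int_{B(0,R)}\rho_{\varepsilon_k}(z)\,\mathrm{d}z+R^2\int_{B(0,R)^c}\frac{\rho_{\varepsilon_k}(z)}{|z|^2}\,\mathrm{d}z\right]\le M;$$ (ii) the sequence $\{\nu_k\}$ of Radon measures on $\mathbb{R}^N$ defined by $$\langle\nu_k,f\rangle=\int_{\mathbb{R}^N}\rho_{\varepsilon_k}(z)f(z)\,\mathrm{d}z\qquad\text{for all }f\in C_c(\mathbb{R}^N)$$ converges locally weakly-$\ast$ in the sense of Radon measures to $\alpha\delta_0$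 for some constant $\alpha\ge0$, where $\delta_0$ is the Dirac delta at $0$.
   Context: Functions $u$ are real-valued. $B(0,R)$ is the open ball in $\mathbb{R}^N$ of center $0$ and radius $R$, and $B(0,R)^c$ is its complement. $H^1(\mathbb{R}^N)$ is the space of $u\in L^2(\mathbb{R}^N)$ whose distributional gradient is in $L^2(\mathbb{R}^N)$. The functionals $\mathscr{F}_\varepsilon$ take values in $[0,+\infty]$. A positive Radon measure is a positive Borel measure that is finite on compact sets. Local weak-$\ast$ convergence $\nu_k\to\nu$ of Radon measures on $\mathbb{R}^N$ means $\int f\,\mathrm{d}\nu_k\to\int f\,\mathrm{d}\nu$ for every $f\in C_c(\mathbb{R}^N)$. The measures $\nu_k$ in (ii) are considered for $k$ large enough, since (i) guarantees $\rho_{\varepsilon_k}\in L^1_{\rm loc}(\mathbb{R}^N)$ for such $k$. *)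

(* Defs.v *)
From HB Require Import structures.
From mathcomp Require Import all_boot all_order all_algebra.
From mathcomp Require Import all_classical all_reals all_analysis.
From mathcomp Require Import measurable_realfun.
Import Order.TTheory GRing.Theory Num.Theory.
Import numFieldTopology.Exports numFieldNormedType.Exports.

Set Implicit Arguments.
Unset Strict Implicit.
Unset Printing Implicit Defensive.

Local Open Scope classical_set_scope.
Local Open Scope ring_scope.

HB.instance Definition _ (R : realType) (n : nat) :=
  Measurable.copy 'rV[R]_n (g_sigma_algebraType (@open 'rV[R]_n)).

Section Euclidean.
Context {R : realType} {n : nat}.
Implicit Types x y : 'rV[R]_n.

Definition dotp x y : R := \sum_(i < n) x ord0 i * y ord0 i.

(* The norm of the library on ['rV[R]_n] is the sup norm: it induces the same
   topology, but not the same balls. *)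
Definition enorm x : R := Num.sqrt (dotp x x).

Definition eball (r : R) : set 'rV[R]_n := [set x | enorm x < r].

End Euclidean.

Section Lebesgue.
Context {R : realType}.

Definition rV_cons n (p : R * 'rV[R]_n) : 'rV[R]_n.+1 :=
  \row_i oapp (p.2 ord0) p.1 (unlift ord0 i).

Lemma rV_cons0 n (p : R * 'rV[R]_n) : rV_cons p ord0 ord0 = p.1.
Proof. by rewrite mxE unlift_none. Qed.

Lemma rV_consS n (p : R * 'rV[R]_n) i :
  rV_cons p ord0 (lift ord0 i) = p.2 ord0 i.
Proof. by rewrite mxE liftK. Qed.

Lemma open_rV_measurable n (O : set 'rV[R]_n) : open O -> measurable O.
Proof. by move=> oO; exact: sub_sigma_algebra. Qed.

Lemma open_rV_rat_balls n (O : set 'rV[R]_n) : open O ->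
  O = \bigcup_(qm in [set qm : 'rV[rat]_n * nat |
        ball (map_mx ratr qm.1 : 'rV[R]_n) qm.2.+1%:R^-1 `<=` O])
      ball (map_mx ratr qm.1 : 'rV[R]_n) qm.2.+1%:R^-1.
Proof.
move=> oO; apply/seteqP; split; last by move=> x [qm /= sO /sO].
move=> x Ox.
have /nbhs_ballP[e /= e0 beO] : nbhs x O by exact: open_nbhs_nbhs.
have [m me] : exists m, m.+1%:R^-1 < e / 2.
  have e20 : 0 < e / 2 by rewrite divr_gt0.
  exists (Num.truncn (e / 2)^-1).
  rewrite invf_plt ?posrE//.
  exact: truncnS_gt.
have q_ j : exists q : rat, ratr q \in `](x ord0 j - m.+1%:R^-1), (x ord0 j + m.+1%:R^-1)[%R.
  have [] := @rat_in_itvoo R (x ord0 j - m.+1%:R^-1) (x ord0 j + m.+1%:R^-1).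
    by rewrite ltrD2l gtrN// invr_gt0.
  by move=> q qx; exists q.
pose q := \row_j sval (cid (q_ j)).
have bq : forall j, `|ratr (q ord0 j) - x ord0 j| < m.+1%:R^-1.
  move=> j; rewrite mxE; case: (cid _) => r /= /itvP xr.
  by rewrite ltr_distl !xr.
exists (q, m) => /=.
  move=> y [_ qy]; apply: beO; split => // i j.
  rewrite (ord1 i); have := qy ord0 j; rewrite /ball/= !mxE => qyj.
  have := bq j; rewrite mxE distrC => bqj.
  rewrite [e]splitr.
  apply: (le_lt_trans (ler_distD (ratr (sval (cid (q_ j)))) _ _)).
  by apply: ltrD; [apply: lt_trans me|apply: lt_trans me].
split => [|i j]; first by rewrite invr_gt0.
by rewrite (ord1 i) /ball/= mxE; exact: bq.
Qed.

Lemma bigcup_countType_measurable d (T : measurableType d) (I : countType)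
    (D : set I) (F : I -> set T) :
  (forall i, D i -> measurable (F i)) -> measurable (\bigcup_(i in D) F i).
Proof.
move=> mF; rewrite [X in measurable X](_ : _ =
    \bigcup_k (oapp (fun i => if i \in D then F i else set0) set0 (unpickle k))).
  apply: bigcupT_measurable => k.
  case: (unpickle k) => [i|] /=; last exact: measurable0.
  by case: ifPn => [/set_mem/mF|_]//; exact: measurable0.
apply/seteqP; split => x.
  by move=> [i Di Fx]; exists (pickle i) => //=; rewrite pickleK/= mem_set//.
move=> [k _]; case: (unpickle k) => //= i.
by case: ifPn => // /set_mem Di Fx; exists i.
Qed.

Lemma measurable_rV_cons n : measurable_fun setT (@rV_cons n).
Proof.
apply: (@measurability _ _ _ _ _ _ (@open 'rV[R]_n.+1)) => //.
move=> _ [U oU <-]; rewrite setTI (open_rV_rat_balls oU) preimage_bigcup.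
apply: bigcup_countType_measurable => -[q m] _ /=.
set e : R := m.+1%:R^-1.
have e0 : 0 < e by rewrite invr_gt0.
rewrite [X in measurable X](_ : _ =
  ball (ratr (q ord0 ord0) : R) e `*`
  ball (\row_j ratr (q ord0 (lift ord0 j)) : 'rV[R]_n) e).
  apply: measurableX; last first.
    by apply: open_rV_measurable; exact: ball_open.
  by exact: measurable_ball.
apply/seteqP; split => -[a y] /=.
  move=> -[_ H]; split => /=.
    by have := H ord0 ord0; rewrite rV_cons0 mxE.
  split => // i j; have := H ord0 (lift ord0 j).
  by rewrite (ord1 i) rV_consS !mxE.
move=> -[/= H0 [_ H]]; split => // i j; rewrite (ord1 i).
have [k ->|->] := unliftP ord0 j.
  by rewrite rV_consS/=; have := H ord0 k; rewrite !mxE.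
by rewrite rV_cons0 mxE.
Qed.

Definition rV_uncons n (x : 'rV[R]_n.+1) : R * 'rV[R]_n :=
  (x ord0 ord0, \row_j x ord0 (lift ord0 j)).

Lemma rV_consK n : cancel (@rV_cons n) (@rV_uncons n).
Proof.
move=> [a y]; rewrite /rV_uncons rV_cons0; congr (_, _).
by apply/rowP => j; rewrite mxE rV_consS.
Qed.

Lemma continuous_rV_measurable n (f : 'rV[R]_n -> R) :
  continuous f -> measurable_fun setT f.
Proof.
move=> /continuousP cf.
apply: (measurability _ (RGenOpens.measurableE R)).
move=> _ [_ [a [b ->] <-]]; rewrite setTI; apply: open_rV_measurable.
exact/cf/interval_open.
Qed.

Lemma measurable_rV_uncons n : measurable_fun setT (@rV_uncons n).
Proof.
apply/measurable_fun_pairP; split.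
  by apply: continuous_rV_measurable => x; exact: coord_continuous.
apply: (@measurability _ _ _ _ _ _ (@open 'rV[R]_n)) => //.
move=> _ [U oU <-]; rewrite setTI; apply: open_rV_measurable.
suff /continuousP : continuous (snd \o @rV_uncons n) by exact.
move=> x A /nbhs_ballP[e /= e0 eA].
apply: (filterS _ (nbhsx_ballx x e e0)) => y [_ xy]; apply: eA; split => // i j.
by rewrite !mxE; exact: xy.
Qed.

Section lebesgue_step.
Local Open Scope ereal_scope.
Variables (n : nat) (mu : {sigma_finite_measure set 'rV[R]_n -> \bar R}).

Definition lebesgue_rV_step : set 'rV[R]_n.+1 -> \bar R :=
  pushforward (@lebesgue_measure R \x mu) (@rV_cons n).

Let mE A : measurable A -> measurable (@rV_cons n @^-1` A).
Proof. by move=> mA; rewrite -[X in measurable X]setTI; exact: measurable_rV_cons. Qed.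

Let step0 : lebesgue_rV_step set0 = 0.
Proof. by rewrite /lebesgue_rV_step /pushforward preimage_set0 measure0. Qed.

Let step_ge0 A : 0 <= lebesgue_rV_step A.
Proof. exact: (measure_ge0 (@lebesgue_measure R \x mu)). Qed.

Let step_sigma_additive : semi_sigma_additive lebesgue_rV_step.
Proof.
move=> F mF tF mUF; rewrite /lebesgue_rV_step /pushforward preimage_bigcup.
apply: (@measure_semi_sigma_additive _ _ _ (@lebesgue_measure R \x mu)).
- by move=> k; apply: mE; exact: mF.
- apply/trivIsetP => /= i j _ _ ij; rewrite -preimage_setI.
  by move/trivIsetP : tF => /(_ _ _ _ _ ij) ->//; rewrite preimage_set0.
- by rewrite -preimage_bigcup; apply: mE; exact: mUF.
Qed.

HB.instance Definition _ := isMeasure.Build _ _ _ lebesgue_rV_step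
  step0 step_ge0 step_sigma_additive.

Let step_sigma_finite : sigma_finite setT lebesgue_rV_step.
Proof.
have [F FT mF] : sigma_finite setT (@lebesgue_measure R \x mu).
  have /sigma_finiteP[F [TF ndF Foo]] := sigma_finiteT (@lebesgue_measure R).
  have /sigma_finiteP[G [TG ndG Goo]] := sigma_finiteT mu.
  exists (fun k => F k `*` G k).
    apply/seteqP; split => // -[x y] _.
    have [i _ Fix] : (\bigcup_i F i) x by rewrite -TF.
    have [j _ Gjy] : (\bigcup_j G j) y by rewrite -TG.
    exists (maxn i j) => //; split => /=.
    - by move: x Fix; exact/subsetPset/ndF/leq_maxl.
    - by move: y Gjy; exact/subsetPset/ndG/leq_maxr.
  move=> k; have [? ?] := Foo k; have [? ?] := Goo k.
  split; first exact: measurableX.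
  by rewrite product_measure1E// lte_mul_pinfty// ge0_fin_numE.
exists (fun k => @rV_uncons n @^-1` F k).
  by rewrite -preimage_bigcup -FT.
move=> k; have [mFk Fky] := mF k; split.
  by rewrite -[X in measurable X]setTI; exact: measurable_rV_uncons.
rewrite /lebesgue_rV_step /pushforward -comp_preimage.
by rewrite (_ : _ \o _ = id)//; apply/funext => p; exact: rV_consK.
Qed.

HB.instance Definition _ := Measure_isSigmaFinite.Build _ _ _ lebesgue_rV_step
  step_sigma_finite.

End lebesgue_step.

Fixpoint lebesgue_rV n : {sigma_finite_measure set 'rV[R]_n -> \bar R} :=
  if n is m.+1 then lebesgue_rV_step (lebesgue_rV m) else \d_(0 : 'rV[R]_0).

Lemma lebesgue_rV_box n (A : 'I_n -> set R) : (forall i, measurable (A i)) ->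
  lebesgue_rV n [set x | forall i, A i (x ord0 i)] =
  (\big[*%E/1]_(i < n) lebesgue_measure (A i))%E.
Proof.
elim: n A => [|n IHn] A mA.
  by rewrite big_ord0 /= diracE mem_set// => -[].
rewrite big_ord_recl /= -(IHn (A \o lift ord0)); last by move=> i; exact: mA.
have mB : measurable [set x : 'rV[R]_n | forall i, (A \o lift ord0) i (x ord0 i)].
  rewrite [X in measurable X](_ : _ = ~` \bigcup_i
      ~` ((fun x : 'rV[R]_n => x ord0 i) @^-1` A (lift ord0 i))).
    apply: measurableC; apply: bigcup_countType_measurable => i _.
    apply: measurableC; rewrite -[X in measurable X]setTI.
    have mi : measurable_fun setT (fun x : 'rV[R]_n => x ord0 i).
      by apply: continuous_rV_measurable => x; exact: coord_continuous.
    by apply: mi => //; exact: mA.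
  rewrite setC_bigcup; apply/seteqP; split => x /= H i.
    by move=> _; rewrite setCK; exact: H.
  by have := H i Logic.I; rewrite setCK.
set B := [set x : 'rV[R]_n | _] in mB *.
transitivity ((lebesgue_measure \x lebesgue_rV n)%E (A ord0 `*` B)); last first.
  by rewrite product_measure1E//; exact: mA.
rewrite /lebesgue_rV_step /pushforward.
congr (product_measure1 _ _ _); apply/seteqP; split => -[a y] /=.
  move=> H; split => [|i].
    by have := H ord0; rewrite rV_cons0.
  by have := H (lift ord0 i); rewrite rV_consS.
move=> [H0 H] i; have [k ->|->] := unliftP ord0 i.
  by rewrite rV_consS; exact: H.
by rewrite rV_cons0.
Qed.

End Lebesgue.

Definition sphere (R : realType) (n : nat) : Type :=
  set_type [set x : 'rV[R]_n.+1 | enorm x = 1].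

Section Sphere.
Context {R : realType} {n : nat}.

Let enorm_e0 : (delta_mx ord0 ord0 : 'rV[R]_n.+1) \in
  [set x : 'rV[R]_n.+1 | enorm x = 1].
Proof.
rewrite inE /= /enorm /dotp (bigD1 ord0)//= big1 ?addr0.
  by rewrite !mxE !eqxx mulr1 sqrtr1.
by move=> i i0; rewrite !mxE eqxx/= (negbTE i0) mulr0.
Qed.

HB.instance Definition _ := Topological.on (sphere R n).
HB.instance Definition _ := isPointed.Build (sphere R n) 
  (exist (fun x => x \in [set x : 'rV[R]_n.+1 | enorm x = 1]) _ enorm_e0).
HB.instance Definition _ := Measurable.copy (sphere R n)
  (g_sigma_algebraType (@open (sphere R n))).

End Sphere.

Definition radon_measure (R : realType) (T : topologicalType)
    (mu : set T -> \bar R) : Prop :=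
  forall K : set T, compact K -> (mu K < +oo)%E.

Section FunctionSpaces.
Context {R : realType} {n : nat}.
Implicit Types (f u phi : 'rV[R]_n -> R) (g : 'rV[R]_n -> 'rV[R]_n).

Definition lebesgue_measurable_fun f : Prop :=
  forall Y : set R, measurable Y ->
    completed_algebra_gen (lebesgue_rV n) (f @^-1` Y).

Definition compactly_supported f : Prop :=
  compact (closure [set x | f x != 0]).

Definition Cc f : Prop := continuous f /\ compactly_supported f.

Definition partial (i : 'I_n) f : 'rV[R]_n -> R :=
  fun x => 'D_(delta_mx ord0 i) f x.

Definition smooth f : Prop :=
  forall (s : seq 'I_n) x, differentiable (foldr partial f s) x.

Definition test_function phi : Prop := smooth phi /\ compactly_supported phi.

Definition distributional_gradient u g : Prop :=
  forall phi, test_function phi -> forall i : 'I_n,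
    (\int[lebesgue_rV n]_x (u x * partial i phi x)%:E =
     - \int[lebesgue_rV n]_x (g x ord0 i * phi x)%:E)%E.

(* [H1_gradient u g]: [u] belongs to H^1 and [g] represents its gradient. *)
Definition H1_gradient u g : Prop :=
  [/\ u \in Lfun (lebesgue_rV n) 2%:E,
      forall i, (fun x => g x ord0 i) \in Lfun (lebesgue_rV n) 2%:E &
      distributional_gradient u g].

(* On the null set [x = y] the quotient is [0], since [0^-1 = 0]. When [rho]
   is Lebesgue but not Borel measurable, the integral, a supremum over Borel
   simple functions below the nonnegative integrand, is still its integral for
   the completed measure. *)
Definition nonlocal_energy (rho : 'rV[R]_n -> R) u : \bar R :=
  ((2^-1)%:E * \int[lebesgue_rV n \x lebesgue_rV n]_p
     (rho (p.2 - p.1)%R *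
      (`|u p.2 - u p.1| ^+ 2 / enorm (p.2 - p.1) ^+ 2))%:E)%E.

Definition locally_weak_star_cvg
    (nu : nat -> {measure set 'rV[R]_n -> \bar R})
    (nu0 : {measure set 'rV[R]_n -> \bar R}) : Prop :=
  forall f, Cc f ->
    (\int[nu k]_z (f z)%:E)%E @[k --> \oo] --> (\int[nu0]_z (f z)%:E)%E.

End FunctionSpaces.

(* Main.v *)
Require Import Defs.
From HB Require Import structures.
From mathcomp Require Import all_boot all_order all_algebra.
From mathcomp Require Import all_classical all_reals all_analysis.
From mathcomp Require Import measurable_realfun.
From mathcomp Require Import ring lra.
Import Order.TTheory GRing.Theory Num.Theory.
Import numFieldTopology.Exports numFieldNormedType.Exports.

Set Implicit Arguments.
Unset Strict Implicit.
Unset Printing Implicit Defensive.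

Local Open Scope classical_set_scope.
Local Open Scope ring_scope.

(* Test the hypothesis on the gaussians [u_t(x) = exp(-t|x|^2/2)] only.
   Completing the square, [|u_t(. + z) - u_t|_2^2 = 2 c_t (1 - exp(-t|z|^2/4))]
   with [c_t = \int exp(-t|x|^2)], so the energy of [u_t] is [c_t Phi_k(t)] where
   [Phi_k(t) = \int rho_k(z) |z|^-2 (1 - exp(-t|z|^2/4)) dz]. Integrating by
   parts, [\int (x.s)^2 exp(-t|x|^2) dx = c_t / (2t)] for every unit vector [s],
   so the limit energy of [u_t] is [c_t t K] with [K = lambda(S) / 2]. Hence
   [Phi_k(t) --> t K] for every [t > 0].
   (i) Since [min(1, p) <= 2 (1 - exp(-p))], the quantity to bound is at most
   [2 r^2 Phi_k(4/r^2)], which tends to [8 K].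
   (ii) [4 Phi_k(1/4) - Phi_k(1) --> 0], and with [s = exp(-|z|^2/16)] its density
   is [rho_k(z) |z|^-2 (3 - 4s + s^4)], where [3 - 4s + s^4 > 0] away from [z = 0]:
   the mass concentrates at the origin. There the density of [Phi_k(1)] is
   equivalent to [rho_k / 4], so the mass tends to [4 K]. *)

(** The limit of [Phi_k(t)] is linear in [t], whereas [1 - exp(-t|z|^2/4)] is strictly concave in
    [t] unless [z = 0]. This mismatch is what drives the mass to the origin, and
    [4 Phi_k(1/4) - Phi_k(1)] measures it; the ratio 4 of the two parameters turns its density into
    a polynomial in [s]. As gaussians are radial, the limit energy sees [lambda] only through its
    total mass, so the limit is identified directly, without extracting subsequences. The obstacle
    is measurability: [rho] is Lebesgue measurable, while Tonelli and translation invariance are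
    applied to Borel functions. Each [rho (eps k)] is therefore replaced by a Borel function [r k]
    that agrees with it off a null set [N k]. The double integral does not change, because the pairs
    with [y - x] in [N k] form a null set of the product. Moreover [r k] is made to vanish at the
    origin, where the density of [Phi_k] is 0 and controls nothing. *)

(** * Null sets and densities *)

Section general_measure.
Context d (T : measurableType d) (R : realType).
Variable mu : {measure set T -> \bar R}.
Local Open Scope ereal_scope.

Import HBNNSimple.

(* Every simple function below [f] can be cut off on [N] without changing its
   integral, so that no measurability is needed. *)
Lemma ge0_integral_eq_off_null (D N : set T) (f g : T -> \bar R) :
  measurable N -> mu N = 0 ->
  (forall x, D x -> 0 <= f x) -> (forall x, D x -> 0 <= g x) ->
  (forall x, D x -> ~ N x -> f x = g x) ->
  \int[mu]_(x in D) f x = \int[mu]_(x in D) g x.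
Proof.
move=> mN N0.
have le_int (f1 g1 : T -> \bar R) : (forall x, 0 <= f1 x) ->
    (forall x, 0 <= g1 x) -> (forall x, ~ N x -> f1 x = g1 x) ->
    \int[mu]_x f1 x <= \int[mu]_x g1 x.
  move=> f10 g10 fg; rewrite !ge0_integralTE//.
  apply: ge_ereal_sup => _ [h /= hf <-].
  pose h' := proj_nnsfun h (measurableC mN).
  have -> : sintegral mu h = sintegral mu h'.
    rewrite -!integralT_nnsfun; apply: ge0_ae_eq_integral => //.
    - exact/measurable_EFinP.
    - exact/measurable_EFinP.
    - by move=> x _; rewrite lee_fin.
    - by move=> x _; rewrite lee_fin fun_ge0.
    exists N; split => // x /=; apply: contra_notP => Nx _.
    by rewrite /= mindicE mem_set ?mulr1.
  apply: ereal_sup_ubound; exists h' => // x; rewrite /= mindicE.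
  have [Nx|Nx] := pselect (N x).
    by rewrite memNset ?mulr0//=; apply: contra_not_not Nx.
  by rewrite mem_set// mulr1 -fg.
move=> f0 g0 fg; rewrite !(integral_mkcond D); apply/eqP.
rewrite eq_le !le_int//; try by move=> x; exact: erestrict_ge0.
  by move=> x Nx; rewrite !patchE; case: ifPn => // /set_mem Dx; rewrite fg.
by move=> x Nx; rewrite !patchE; case: ifPn => // /set_mem Dx; rewrite fg.
Qed.

Lemma integral_eq_off_null (N : set T) (f g : T -> \bar R) :
  measurable N -> mu N = 0 -> (forall x, ~ N x -> f x = g x) ->
  \int[mu]_x f x = \int[mu]_x g x.
Proof.
move=> mN N0 fg; rewrite integralE [RHS]integralE; congr (_ - _);
  apply: (ge0_integral_eq_off_null mN N0) => //.
- by move=> x _ Nx; rewrite !funeposE fg.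
- by move=> x _ Nx; rewrite !funenegE fg.
Qed.

(** This supplies the measures of (ii). The integral formula goes from simple functions to
    nonnegative ones by monotone convergence. Multiplication by [f >= 0] commutes with positive and
    negative parts, so the formula then holds for every measurable [g], integrable or not. *)
Lemma density_measure (f : T -> R) :
  measurable_fun setT f -> (forall x, 0 <= f x)%R ->
  exists2 nu : {measure set T -> \bar R},
    (forall A, measurable A -> nu A = \int[mu]_(x in A) (f x)%:E) &
    (forall g : T -> R, measurable_fun setT g ->
       \int[nu]_x (g x)%:E = \int[mu]_x (f x * g x)%:E).
Proof.
move=> mf f0.
have mEf : measurable_fun setT (EFin \o f) by exact/measurable_EFinP.
have Ef0 x : 0 <= (f x)%:E by rewrite lee_fin.
pose nu0 (A : set T) := \int[mu]_(x in A) (f x)%:E.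
have nu00 : nu0 set0 = 0 by rewrite /nu0 integral_set0.
have nu0_ge0 A : 0 <= nu0 A by apply: integral_ge0.
have nu0_sigma : semi_sigma_additive nu0.
  move=> F mF tF mUF; rewrite /nu0 ge0_integral_bigcup//.
    by apply: is_cvg_ereal_nneg_natsum => n _; exact: integral_ge0.
  exact: measurable_funTS.
pose mx := isMeasure.Build _ _ _ nu0 nu00 nu0_ge0 nu0_sigma.
pose nu : {measure set T -> \bar R} := HB.pack nu0 mx.
have simple (h : {nnsfun T >-> R}) :
    \int[nu]_x (h x)%:E = \int[mu]_x ((f x)%:E * (h x)%:E).
  rewrite integralT_nnsfun sintegralE.
  under [RHS]eq_integral.
    move=> x _; rewrite fimfunE -fsumEFin// ge0_mule_fsumr; last first.
      by move=> r; exact: nnfun_muleindic_ge0.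
    over.
  rewrite ge0_integral_fsum//; first last.
  - by move=> r x _; rewrite mule_ge0// nnfun_muleindic_ge0.
  - move=> r; apply: emeasurable_funM => //.
    by apply/measurable_EFinP; exact: measurable_funM.
  apply: eq_fsbigr => r /set_mem [t _ hr].
  under eq_integral do rewrite EFinM muleCA.
  rewrite ge0_integralZl//; first last.
  - by rewrite -hr lee_fin.
  - by move=> x _; rewrite mule_ge0// lee_fin.
  - by apply: emeasurable_funM => //; exact/measurable_EFinP.
  congr (_ * _); rewrite /= /nu0 integral_mkcond; apply: eq_integral => x _.
  by rewrite epatch_indic.
have ge0_int (g : T -> \bar R) : measurable_fun setT g ->
    (forall x, 0 <= g x) -> \int[nu]_x g x = \int[mu]_x ((f x)%:E * g x).
  move=> mg g0.
  pose g_ := nnsfun_approx measurableT mg.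
  have gE x : g x = limn (fun n => (g_ n x)%:E).
    by apply/esym/cvg_lim => //; exact: cvg_nnsfun_approx.
  under eq_integral do rewrite gE.
  rewrite monotone_convergence//; last 3 first.
  - by move=> n; exact/measurable_EFinP.
  - by move=> n x _; rewrite lee_fin.
  - by move=> x _ a b ab; rewrite lee_fin; exact/lefP/nd_nnsfun_approx.
  under eq_fun do rewrite simple.
  rewrite -monotone_convergence//; first last.
  - move=> x _ a b ab; rewrite lee_wpmul2l// lee_fin.
    exact/lefP/nd_nnsfun_approx.
  - by move=> n x _; rewrite mule_ge0// lee_fin.
  - by move=> n; apply: emeasurable_funM => //; exact/measurable_EFinP.
  apply: eq_integral => x _; rewrite limeMl// -?gE//.
  exact: cvg_nnsfun_approx.
exists nu => // g mg.
have mEg : measurable_fun setT (EFin \o g) by exact/measurable_EFinP.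
rewrite integralE [RHS]integralE; congr (_ - _).
  rewrite ge0_int//; last exact: measurable_funepos.
  apply: eq_integral => x _; rewrite !funeposE /= -!EFin_max -EFinM.
  by rewrite maxr_pMr// mulr0.
rewrite ge0_int//; last exact: measurable_funeneg.
apply: eq_integral => x _; rewrite !funenegE /= -!EFin_max -EFinM.
by rewrite maxr_pMr// mulr0 mulrN.
Qed.

End general_measure.

(** For each rational [q], the set where [f > q] coincides with a Borel set off a null set. The
    union [N] of these countably many null sets works for all [q] at once, and rational levels
    generate all the others. *)
Lemma lebesgue_measurable_fun_off_null (R : realType) n (f : 'rV[R]_n -> R) :
  lebesgue_measurable_fun f ->
  exists N, [/\ measurable N, lebesgue_rV n N = 0%E &
    measurable_fun setT (fun x => if x \in N then 0 else f x)].
Proof.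
move=> mf.
have AN_ (q : rat) : exists AN : set 'rV[R]_n * set 'rV[R]_n,
    [/\ measurable AN.1, measurable AN.2, lebesgue_rV n AN.2 = 0%E &
      forall x, ~ AN.2 x -> (ratr q < f x) <-> AN.1 x].
  have [A mA [N0 [N [mN N00 N0N]]] AN0] := mf `]ratr q, +oo[%classic
      (measurable_itv _).
  exists (A, N); split => //= x Nx.
  have -> : (ratr q < f x) = (f @^-1` `]ratr q, +oo[%classic) x :> Prop.
    by rewrite /= in_itv/= andbT.
  rewrite -AN0; split => [[//|/N0N]|]; last by left.
  by move/Nx.
pose q_ k : rat := odflt 0 (unpickle k).
pose N := \bigcup_k (sval (cid (AN_ (q_ k)))).2.
have mN : measurable N.
  by apply: bigcupT_measurable => k; case: cid => ? [].
exists N; split => //.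
  apply: measure_negligible => //; apply: negligible_bigcup => k.
  by case: cid => -[A M] /= [_ mM M0 _]; exists M; split.
apply: (measurability _ (RGenOInfty.measurableE R)) => //.
move=> /= _ [_ [a ->] <-]; rewrite setTI.
(* The modified function is 0 on [N], so [N] enters the superlevel set exactly when [a < 0]. *)
rewrite [X in measurable X](_ : _ =
    (\bigcup_(k in [set k | a < ratr (q_ k)]) (sval (cid (AN_ (q_ k)))).1
      `\` N) `|` (if a < 0 then N else set0)).
  apply: measurableU; last by case: ifP.
  apply: measurableD => //; apply: bigcup_measurable => k _.
  by case: cid => -[A M] /= [].
apply/seteqP; split => x /=; rewrite in_itv/= andbT.
  case: ifPn => [/set_mem Nx a0|/negP Nx afx].
    by right; rewrite a0.
  left; split; last by apply: contra_not Nx => /mem_set.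
  have [q] := rat_in_itvoo afx; rewrite in_itv/= => /andP[aq qf].
  exists (pickle q); rewrite /= /q_ pickleK//=.
  have {}Nx : ~ (sval (cid (AN_ (q_ (pickle q))))).2 x.
    by apply: contra_not Nx => Nx; apply/mem_set; exists (pickle q).
  by move: Nx; rewrite /q_ pickleK/=; case: cid => -[A M] /= [_ _ _ /(_ x)] AM
      Mx; apply/AM.
case=> [[[k aq] Ax Nx]|].
  rewrite memNset//; apply: (lt_trans aq).
  have {}Nx : ~ (sval (cid (AN_ (q_ k)))).2 x by apply: contra_not Nx => Nx;
      exists k.
  by move: Ax Nx; case: cid => -[A M] /= [_ _ _ /(_ x)] AM Ax Mx; apply/AM.
by case: ifP => // a0 Nx; rewrite mem_set.
Qed.

(** * Lebesgue measure on row vectors *)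

Section rV_measurability.
Context {R : realType} {d : measure_display} {T : measurableType d}.

(** An open set is a countable union of sup-norm balls with rational data, and membership in such a
    ball is a conjunction of conditions on single coordinates. *)
Lemma measurable_fun_rV n (F : T -> 'rV[R]_n) :
  (forall i, measurable_fun setT (fun x => F x ord0 i)) ->
  measurable_fun setT F.
Proof.
move=> mF; apply: (@measurability _ _ _ _ _ _ (@open 'rV[R]_n)) => //.
move=> _ [U oU <-]; rewrite setTI (open_rV_rat_balls oU) preimage_bigcup.
apply: bigcup_countType_measurable => -[q m] _ /=.
set e : R := m.+1%:R^-1.
have e0 : 0 < e by rewrite invr_gt0.
rewrite [X in measurable X](_ : _ = ~` \bigcup_i
    ~` ((fun x => F x ord0 i) @^-1` ball (ratr (q ord0 i) : R) e)).
  apply: measurableC; apply: bigcup_countType_measurable => i _.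
  apply: measurableC; rewrite -[X in measurable X]setTI.
  by apply: mF => //; exact: measurable_ball.
rewrite setC_bigcup; apply/seteqP; split => x /= H.
  by move=> i _; rewrite setCK/=; have := H.2 ord0 i; rewrite !mxE.
split => // i j; rewrite (ord1 i) !mxE.
by have := H j Logic.I; rewrite setCK.
Qed.

Lemma measurable_rV_coord n i (F : T -> 'rV[R]_n) :
  measurable_fun setT F -> measurable_fun setT (fun x => F x ord0 i).
Proof.
move=> mF; apply: (@measurableT_comp _ _ _ _ _ _ (fun x : 'rV[R]_n => x ord0
    i)) => //.
by apply: continuous_rV_measurable => x; exact: coord_continuous.
Qed.

Lemma measurable_rVD n (F G : T -> 'rV[R]_n) :
  measurable_fun setT F -> measurable_fun setT G ->
  measurable_fun setT (fun x => F x + G x).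
Proof.
move=> mF mG; apply: measurable_fun_rV => i.
under eq_fun do rewrite mxE.
by apply: measurable_funD; exact: measurable_rV_coord.
Qed.

Lemma measurable_rVN n (F : T -> 'rV[R]_n) :
  measurable_fun setT F -> measurable_fun setT (fun x => - F x).
Proof.
move=> mF; apply: measurable_fun_rV => i.
under eq_fun do rewrite mxE.
by apply: measurableT_comp => //; exact: measurable_rV_coord.
Qed.

Lemma measurable_dotp n (F G : T -> 'rV[R]_n) :
  measurable_fun setT F -> measurable_fun setT G ->
  measurable_fun setT (fun x => dotp (F x) (G x)).
Proof.
move=> mF mG; apply: measurable_sum => i.
by apply: measurable_funM; exact: measurable_rV_coord.
Qed.

Lemma measurable_enorm n (F : T -> 'rV[R]_n) :
  measurable_fun setT F -> measurable_fun setT (fun x => enorm (F x)).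
Proof.
move=> mF.
have ms : measurable_fun setT (@Num.sqrt R).
  by apply: continuous_measurable_fun; exact: sqrt_continuous.
exact: (measurableT_comp ms (measurable_dotp mF mF)).
Qed.

End rV_measurability.

Section translation_invariance.
Context {R : realType}.

Lemma lebesgue_measureD (a : R) (A : set R) : measurable A ->
  pushforward (@lebesgue_measure R) (fun x : measurableTypeR R => x + a) A =
  lebesgue_measure A.
Proof.
move=> mA.
have mD : measurable_fun setT (fun x : measurableTypeR R => x + a :
    measurableTypeR R).
  exact: measurable_funD.
pose D : {mfun measurableTypeR R >-> measurableTypeR R} :=
  HB.pack (fun x : measurableTypeR R => x + a : measurableTypeR R)
    (isMeasurableFun.Build _ _ _ _ _ mD).
apply/esym; apply: (lebesgue_measure_unique
  (mu := pushforward (@lebesgue_measure R) D)) => //= _ [[b c]] _ <-.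
rewrite /pushforward (_ : _ @^-1` _ = `](b - a), (c - a)]%classic); last first.
  by apply/seteqP; split => x /=; rewrite !in_itv/= ltrBlDr lerBrDr.
rewrite !lebesgue_measure_itv/= !lte_fin ltrD2r; case: ifPn => // _.
by congr EFin; ring.
Qed.

Local Open Scope ereal_scope.

Lemma ge0_integral_translation1 (a : R) (f : R -> \bar R) :
  measurable_fun setT f -> (forall x, 0 <= f x) ->
  \int[lebesgue_measure]_x f (x + a)%R = \int[lebesgue_measure]_x f x.
Proof.
move=> mf f0.
have mD : measurable_fun setT (fun x : measurableTypeR R => x + a :
    measurableTypeR R)%R.
  by apply: measurable_funD.
transitivity (\int[pushforward (@lebesgue_measure R)
    (fun x : measurableTypeR R => x + a : measurableTypeR R)%R]_x f x).
  by rewrite ge0_integral_pushforward//= preimage_setT.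
by apply: eq_measure_integral => //= A mA _; exact: lebesgue_measureD.
Qed.

Lemma ge0_integral_rV_cons n (f : 'rV[R]_n.+1 -> \bar R) :
  measurable_fun setT f -> (forall x, 0 <= f x) ->
  \int[lebesgue_rV n.+1]_x f x =
  \int[lebesgue_measure]_a \int[lebesgue_rV n]_y f (rV_cons (a, y)).
Proof.
move=> mf f0; rewrite /= /lebesgue_rV_step.
rewrite ge0_integral_pushforward//=; last exact: measurable_rV_cons.
rewrite preimage_setT fubini_tonelli1//.
by apply: measurableT_comp => //; exact: measurable_rV_cons.
Qed.

Lemma measurable_integral_rV_cons n (f : 'rV[R]_n.+1 -> \bar R) :
  measurable_fun setT f -> (forall x, 0 <= f x) ->
  measurable_fun setT (fun a => \int[lebesgue_rV n]_y f (rV_cons (a, y))).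
Proof.
move=> mf f0.
apply: (@measurable_fun_fubini_tonelli_F _ _ _ _ _ (lebesgue_rV n) (f \o
    @rV_cons R n)) => //.
  by apply: measurableT_comp => //; exact: measurable_rV_cons.
by move=> p /=.
Qed.

Lemma rV_consD n (a b : R) (x y : 'rV[R]_n) :
  rV_cons ((a + b)%R, (x + y)%R) = (rV_cons (a, x) + rV_cons (b, y))%R.
Proof.
apply/rowP => j; rewrite [RHS]mxE; have [k ->|->] := unliftP ord0 j.
  by rewrite !rV_consS [LHS]mxE.
by rewrite !rV_cons0.
Qed.

Lemma rV_unconsK n : cancel (@rV_uncons R n) (@rV_cons R n).
Proof.
move=> x; apply/rowP => j; have [k ->|->] := unliftP ord0 j.
  by rewrite rV_consS mxE.
by rewrite rV_cons0.
Qed.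

Lemma measurable_rV_translation n (z : 'rV[R]_n) :
  measurable_fun setT (fun x : 'rV[R]_n => x + z)%R.
Proof.
apply: (measurable_rVD (F := idfun) (G := cst z)).
  exact: measurable_id.
exact: measurable_cst.
Qed.

(** Tonelli splits off the first coordinate; the line and the remaining coordinates are then
    translated separately. *)
Lemma ge0_integral_translation n (z : 'rV[R]_n) (f : 'rV[R]_n -> \bar R) :
  measurable_fun setT f -> (forall x, 0 <= f x) ->
  \int[lebesgue_rV n]_x f (x + z)%R = \int[lebesgue_rV n]_x f x.
Proof.
elim: n z f => [|n IH] z f mf f0.
  by apply: eq_integral => x _; congr f; apply/rowP => -[].
have mfz : measurable_fun setT (fun x : 'rV[R]_n.+1 => f (x + z)%R).
  exact: measurableT_comp (measurable_rV_translation z).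
rewrite (ge0_integral_rV_cons mfz)//.
apply: etrans (esym (ge0_integral_rV_cons mf f0)).
rewrite -[RHS](ge0_integral_translation1 (rV_uncons z).1); last 2 first.
- exact: measurable_integral_rV_cons.
- by move=> a; exact: integral_ge0.
apply: eq_integral => a _.
rewrite -[RHS](IH (rV_uncons z).2)//.
  apply: eq_integral => y _; congr f.
  by rewrite rV_consD -surjective_pairing rV_unconsK.
apply: measurableT_comp => //.
apply: (@measurableT_comp _ _ _ _ _ _ (@rV_cons R n)) => //.
exact: measurable_rV_cons.
Qed.

Lemma integral_translation n (z : 'rV[R]_n) (f : 'rV[R]_n -> \bar R) :
  measurable_fun setT f ->
  \int[lebesgue_rV n]_x f (x + z)%R = \int[lebesgue_rV n]_x f x.
Proof.
move=> mf; rewrite integralE [RHS]integralE.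
congr (_ - _).
  rewrite -(ge0_integral_translation z (measurable_funepos mf))//.
  by apply: eq_integral => x _; rewrite !funeposE.
rewrite -(ge0_integral_translation z (measurable_funeneg mf))//.
by apply: eq_integral => x _; rewrite !funenegE.
Qed.

Lemma integrable_translation n (z : 'rV[R]_n) (f : 'rV[R]_n -> \bar R) :
  (lebesgue_rV n).-integrable setT f ->
  (lebesgue_rV n).-integrable setT (fun x => f (x + z)%R).
Proof.
move=> /integrableP[mf foo]; apply/integrableP; split.
  exact: measurableT_comp (measurable_rV_translation z).
rewrite (@ge0_integral_translation n z (abse \o f))//.
  exact: measurableT_comp.
by move=> x /=.
Qed.

(** A point is a box whose first side has length 0. The dimension must be positive: [lebesgue_rV 0]
    is a Dirac mass. *)
Lemma lebesgue_rV_set1 n (z : 'rV[R]_n.+1) : lebesgue_rV n.+1 [set z] = 0.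
Proof.
have -> : [set z] = [set x | forall i, [set z ord0 i] (x ord0 i)].
  by apply/seteqP; split => [x /= -> //|x /= H]; exact/rowP.
apply: etrans (@lebesgue_rV_box R n.+1 (fun i => [set z ord0 i]) _) _.
  by move=> i; exact: measurable_set1.
by rewrite big_ord_recl lebesgue_measure_set1 mul0e.
Qed.

Lemma measurable_rV_set1 n (z : 'rV[R]_n) : measurable [set z].
Proof.
rewrite [X in measurable X](_ : _ = ~` \bigcup_i
    ~` ((fun x : 'rV[R]_n => x ord0 i) @^-1` [set z ord0 i])).
  apply: measurableC; apply: bigcup_countType_measurable => i _.
  apply: measurableC; rewrite -[X in measurable X]setTI.
  have /= mi := measurable_rV_coord i (@measurable_id _ _ setT : measurable_fun
      setT (@idfun 'rV[R]_n)).
  exact: mi.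
rewrite setC_bigcup; apply/seteqP; split => [x /= -> i _|x /= H].
  by rewrite setCK.
by apply/rowP => i; have := H i Logic.I; rewrite setCK.
Qed.

End translation_invariance.

(** * Gaussians *)

Section dotp_theory.
Context {R : realType} {n : nat}.
Implicit Types (x y z : 'rV[R]_n) (a : R).

Lemma dotpC x y : dotp x y = dotp y x.
Proof. by apply: eq_bigr => i _; rewrite mulrC. Qed.

Lemma dotpDl x y z : dotp (x + y) z = dotp x z + dotp y z.
Proof. by rewrite -big_split/=; apply: eq_bigr => i _; rewrite mxE mulrDl. Qed.

Lemma dotpZl a x y : dotp (a *: x) y = a * dotp x y.
Proof. by rewrite mulr_sumr; apply: eq_bigr => i _; rewrite mxE mulrA. Qed.

Lemma dotpDr x y z : dotp z (x + y) = dotp z x + dotp z y.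
Proof. by rewrite dotpC dotpDl !(dotpC z). Qed.

Lemma dotpZr a x y : dotp y (a *: x) = a * dotp y x.
Proof. by rewrite dotpC dotpZl (dotpC y). Qed.

Lemma dotp_ge0 x : 0 <= dotp x x.
Proof. by apply: sumr_ge0 => i _; rewrite -expr2 sqr_ge0. Qed.

Lemma enorm_ge0 x : 0 <= enorm x. Proof. exact: sqrtr_ge0. Qed.

Lemma enorm_sqr x : enorm x ^+ 2 = dotp x x.
Proof. by rewrite sqr_sqrtr// dotp_ge0. Qed.

Lemma dotp_eq0 x : (dotp x x == 0) = (x == 0).
Proof.
apply/eqP/eqP => [|->]; last by apply: big1 => i _; rewrite mxE mul0r.
move=> /eqP; rewrite psumr_eq0; last by move=> i _; rewrite -expr2 sqr_ge0.
move=> /allP x0; apply/rowP => i; rewrite mxE; apply/eqP.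
by have := x0 i (mem_index_enum i); rewrite /= -expr2 sqrf_eq0.
Qed.

(** Cauchy-Schwarz: the difference of the two sides is the squared norm of the part of [x]
    orthogonal to [y]. *)
Lemma dotp_unit_sqr_le x y : dotp y y = 1 -> dotp x y ^+ 2 <= dotp x x.
Proof.
move=> y1; have := dotp_ge0 (x + (- dotp x y) *: y).
rewrite !(dotpDl, dotpDr, dotpZl, dotpZr) y1 (dotpC y x).
by move=> H; rewrite -subr_ge0; apply: le_trans H _; rewrite le_eqVlt;
    apply/orP; left; apply/eqP; ring.
Qed.

Lemma dotp_delta x i : dotp x (delta_mx ord0 i) = x ord0 i.
Proof.
rewrite /dotp (bigD1 i)//= big1 ?addr0 ?mxE ?eqxx ?mulr1// => j ji.
by rewrite mxE (negbTE ji) andbF mulr0.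
Qed.

Lemma dotp_delta_delta i : dotp (delta_mx ord0 i : 'rV[R]_n) (delta_mx ord0 i) = 1.
Proof. by rewrite dotp_delta mxE !eqxx. Qed.

End dotp_theory.

Section gaussian.
Context {R : realType}.

(** In this parametrisation the test function [u_t] is [gauss (t / 2)]; its square is [gauss t],
    whose integral is [c_t]. *)
Definition gauss n (t : R) (x : 'rV[R]_n) : R := expR (- t * dotp x x).

Lemma gauss_ge0 n t (x : 'rV[R]_n) : 0 <= gauss t x.
Proof. exact: expR_ge0. Qed.

Lemma measurable_gauss n t : measurable_fun setT (@gauss n t).
Proof.
apply: (@measurableT_comp _ _ _ _ _ _ (@expR R) _ (fun x : 'rV[R]_n => - t *
    dotp x x)) => //.
apply: measurable_funM => //.
by apply: (measurable_dotp (F := idfun) (G := idfun)); exact: measurable_id.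
Qed.

Lemma gauss_sqr n t (x : 'rV[R]_n) : gauss (t / 2) x ^+ 2 = gauss t x.
Proof. by rewrite /gauss -expRM_natl; congr expR; field. Qed.

Lemma gauss_rV_cons n t (a : R) (y : 'rV[R]_n) :
  gauss t (rV_cons (a, y)) = expR (- t * a ^+ 2) * gauss t y.
Proof.
rewrite /gauss -expRD; congr expR; rewrite /dotp big_ord_recl !rV_cons0 mulrDr.
by congr (_ + _ * _); apply: eq_bigr => i _; rewrite !rV_consS.
Qed.

Lemma integral_gauss1 (t : R) : 0 < t ->
  exists2 c, 0 < c &
    (\int[lebesgue_measure]_a (expR (- t * a ^+ 2))%:E = c%:E)%E.
Proof.
(* The standard deviation for which the centred normal density is a multiple of [exp(-t a^2)]. *)
move=> t0; pose s : R := Num.sqrt (2 * t)^-1.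
have s0 : 0 < s by rewrite sqrtr_gt0 invr_gt0 mulr_gt0.
have sn0 : s != 0 by rewrite gt_eqF.
have s2 : s ^+ 2 = (2 * t)^-1 by rewrite sqr_sqrtr// invr_ge0 mulr_ge0// ltW.
have p0 := normal_peak_gt0 sn0.
exists (normal_peak s)^-1; first by rewrite invr_gt0.
transitivity (\int[lebesgue_measure]_a ((normal_peak s)^-1%:E * (normal_pdf 0 s
    a)%:E))%E.
  apply: eq_integral => a _; rewrite normal_pdfE// -EFinM mulKf ?gt_eqF//.
  congr (expR _)%:E; rewrite s2 subr0; field.
  by rewrite gt_eqF.
rewrite ge0_integralZl//; last 3 first.
- by apply/measurable_EFinP; exact: measurable_normal_pdf.
- by move=> a _; rewrite lee_fin normal_pdf_ge0.
- by rewrite lee_fin invr_ge0 ltW.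
- by rewrite integral_normal_pdf// mule1.
Qed.

Lemma integral_gauss n (t : R) : 0 < t ->
  exists2 c, 0 < c & (\int[lebesgue_rV n]_x (gauss t x)%:E = c%:E)%E.
Proof.
move=> t0; elim: n => [|n [c c0 IH]].
  exists 1 => //=; rewrite integral_dirac//= ?diracT ?mul1e.
    by rewrite /gauss /dotp big_ord0 mulr0 expR0.
  by apply/measurable_EFinP; exact: measurable_gauss.
have [c1 c10 E1] := integral_gauss1 t0.
exists (c1 * c); first exact: mulr_gt0.
rewrite (@ge0_integral_rV_cons _ _ (fun x => (gauss t x)%:E)); last 2 first.
- by apply/measurable_EFinP; exact: measurable_gauss.
- by move=> x; rewrite lee_fin gauss_ge0.
under eq_integral.
  move=> a _.
  under eq_integral do rewrite gauss_rV_cons EFinM.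
  rewrite ge0_integralZl//; last 2 first.
  - by apply/measurable_EFinP; exact: measurable_gauss.
  - by move=> x _; rewrite lee_fin gauss_ge0.
  rewrite IH.
  over.
rewrite ge0_integralZr//; last 2 first.
- apply/measurable_EFinP; apply: measurableT_comp => //.
  by apply: measurable_funM => //; exact: measurable_funX.
- by rewrite lee_fin ltW.
by rewrite E1 EFinM.
Qed.

Lemma integrable_gauss n (t : R) : 0 < t ->
  (lebesgue_rV n).-integrable setT (fun x => (gauss t x)%:E).
Proof.
move=> t0; apply/integrableP; split.
  by apply/measurable_EFinP; exact: measurable_gauss.
have [c _ E] := integral_gauss n t0.
under eq_integral do rewrite gee0_abs ?lee_fin ?gauss_ge0//.
by rewrite E ltry.
Qed.

(** This is the parallelogram identity around the midpoint [x + z/2]; the shift of the centre then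
    disappears under the integral by translation invariance. *)
Lemma gauss_mul_shift n t (x z : 'rV[R]_n) :
  gauss (t / 2) (x + z) * gauss (t / 2) x =
  gauss t (x + 2^-1 *: z) * expR (- (t / 4 * dotp z z)).
Proof.
rewrite /gauss -!expRD; congr expR.
rewrite !(dotpDl, dotpDr, dotpZl, dotpZr) (dotpC z x).
by field.
Qed.

(* This is where the gaussian is convenient: its autocorrelation is again a
   radial gaussian. *)
Lemma integral_gauss_increment n t (z : 'rV[R]_n) : 0 < t ->
  (\int[lebesgue_rV n]_x ((gauss (t / 2) (x + z) - gauss (t / 2) x) ^+ 2)%:E =
   (2 * (1 - expR (- (t / 4 * dotp z z))))%:E *
   \int[lebesgue_rV n]_x (gauss t x)%:E)%E.
Proof.
move=> t0; have ig := integrable_gauss n t0.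
have [c c0 Ec] := integral_gauss n t0.
have mg := measurable_int _ ig.
have igz w := integrable_translation w ig.
have Ew w : (\int[lebesgue_rV n]_x (gauss t (x + w))%:E = c%:E)%E.
  by rewrite -Ec -(integral_translation w mg).
set e := expR _.
transitivity (\int[lebesgue_rV n]_x (((gauss t (x + z))%:E + (gauss t x)%:E) -
  (2 * e)%:E * (gauss t (x + 2^-1 *: z))%:E))%E.
  apply: eq_integral => x _; rewrite -EFinM -EFinD; congr EFin.
  have := gauss_mul_shift t x z; rewrite -!(gauss_sqr t) -/e => E.
  rewrite sqrrB E gauss_sqr.
  by ring.
rewrite integralB//; last 2 first.
- exact: integrableD.
- exact: integrableZl.
rewrite (integralD measurableT (igz z) ig) (integralZl measurableT (igz _)).
rewrite (Ew z) Ec (Ew (2^-1 *: z)) -!EFinM -EFinD; congr EFin.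
by ring.
Qed.

End gaussian.

(** * Integration by parts *)

Section integral_derivative.
Context {R : realType}.

(* The difference quotients of [f] have zero integral by translation
   invariance, and converge to [df] dominatedly. *)
Lemma integral_directional_derivative n (v : 'rV[R]_n) (f df : 'rV[R]_n -> R)
    (G : 'rV[R]_n -> \bar R) :
  (lebesgue_rV n).-integrable setT (fun x => (f x)%:E) ->
  measurable_fun setT df ->
  (forall x (s : R), is_derive s 1 (fun r : R => f (x + r *: v)) (df (x + s *:
      v))) ->
  (lebesgue_rV n).-integrable setT G ->
  (forall x s, 0 <= s <= 1 -> (`|df (x + s *: v)|%:E <= G x)%E) ->
  (lebesgue_rV n).-integrable setT (fun x => (df x)%:E) /\
  (\int[lebesgue_rV n]_x (df x)%:E = 0)%E.
Proof.
move=> intf mdf Df intG dfG.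
pose h (m : nat) : R := m.+1%:R^-1.
have h0 m : 0 < h m by rewrite invr_gt0.
have h1 m : h m <= 1 by rewrite invf_le1// ler1n.
pose f_ (m : nat) x := ((h m)^-1 * (f (x + h m *: v) - f x))%:E.
have mf : measurable_fun setT f by apply/measurable_EFinP; exact:
    measurable_int intf.
have mfz m : measurable_fun setT (fun x : 'rV[R]_n => f (x + h m *: v)).
  exact: measurableT_comp mf (measurable_rV_translation _).
have mf_ m : measurable_fun setT (f_ m).
  apply/measurable_EFinP; apply: measurable_funM => //.
  by apply: measurable_funB.
have cvg_f_ x : f_ ^~ x @ \oo --> (df x)%:E.
  apply: cvg_EFin; first exact: nearW.
  rewrite (_ : fine \o _ = (fun r : R => r^-1 *: (f (x + (r *: 1 + 0) *: v) - f
      (x + (0 : R) *: v))) \o h); last first.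
    by apply/funext => m /=; rewrite scale0r !addr0 [_ *: 1]mulr1.
  (* Derivatives are limits along punctured neighbourhoods, so the steps must tend to 0 without
     reaching it. *)
  have hE : h @ \oo --> (0 : R)^'.
    move=> A A0; have {}A0 : nbhs (0 : R) [set r | r != 0 -> A r] := A0.
    have [N _ NA] := @cvg_harmonic R _ A0.
    by exists N => // m Nm; apply: (NA m Nm); apply: lt0r_neq0; exact: (h0 m).
  apply: (cvg_comp _ _ hE).
  have -> : df x = 'D_1 (fun r : R => f (x + r *: v)) 0.
    by rewrite (@derive_val _ _ _ _ _ _ _ (Df x 0)) scale0r addr0.
  exact: (@ex_derive _ _ _ _ _ _ _ (Df x 0)).
(* By the mean value theorem the quotient equals [df] at some [x + c v] with [0 <= c <= h m <= 1],
   which is in the range covered by the domination hypothesis. *)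
have f_G x m : (`|f_ m x| <= G x)%E.
  have [|c c01] := @MVT_segment R (fun r : R => f (x + r *: v))
      (fun r => df (x + r *: v)) 0 (h m) (ltW (h0 m)) (fun s _ => Df x s).
    apply: continuous_subspaceT => s.
    by apply: differentiable_continuous; apply/derivable1_diffP; exact:
        (@ex_derive _ _ _ _ _ _ _ (Df x s)).
  rewrite scale0r addr0 subr0 /f_ => ->.
  rewrite mulrCA mulVf ?mulr1 ?gt_eqF//.
  apply: dfG; move: c01; rewrite in_itv/= => /andP[-> c1].
  exact: le_trans c1 (h1 m).
have [idf _ cvgint] := dominated_convergence measurableT mf_
   ((measurable_EFinP _ _).2 mdf) (aeW _ (fun x _ => cvg_f_ x)) intG
   (aeW _ (fun x m _ => f_G x m)).
split => //.
move: cvgint; rewrite (_ : [sequence _]_n = cst 0%E).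
  by move=> /cvg_lim <-//; rewrite lim_cst.
apply/funext => m /=.
have ifz : (lebesgue_rV n).-integrable setT (fun x => (f (x + h m *: v))%:E).
  exact: integrable_translation intf.
transitivity (\int[lebesgue_rV n]_x
    ((h m)^-1%:E * ((f (x + h m *: v))%:E - (f x)%:E)))%E.
  by apply: eq_integral => x _; rewrite -EFinB -EFinM.
rewrite (integralZl measurableT (integrableB measurableT ifz intf)).
rewrite (integralB measurableT ifz intf).
rewrite (integral_translation (h m *: v) (measurable_int _ intf)).
by rewrite subee ?mule0// integrable_fin_num.
Qed.

End integral_derivative.

Section gaussian_bounds.
Context {R : realType} {n : nat}.
Implicit Types (x y w : 'rV[R]_n) (t : R).

Lemma gauss_shift_le t x w : 0 <= t ->
  gauss t (x + w) <= expR (t * dotp w w) * gauss (t / 2) x.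
Proof.
move=> t0; rewrite /gauss -expRD ler_expR.
(* Half of this quantity is exactly the gap between the two exponents. *)
have := mulr_ge0 t0 (dotp_ge0 (x + 2 *: w)).
rewrite !(dotpDl, dotpDr, dotpZl, dotpZr) (dotpC w x) => H.
by lra.
Qed.

(** Half of the exponent absorbs the quadratic factor, since [p <= exp(p)] for [p = t|x|^2/2]. *)
Lemma dotp_gauss_le t x : 0 < t ->
  dotp x x * gauss t x <= 2 / t * gauss (t / 2) x.
Proof.
move=> t0; have -> : gauss t x = gauss (t / 2) x * expR (- (t / 2 * dotp x x)).
  by rewrite /gauss -expRD; congr expR; field.
rewrite mulrCA [leRHS]mulrC ler_wpM2l ?gauss_ge0// expRN ler_pdivrMr ?expR_gt0//.
have := expR_ge1Dx (t / 2 * dotp x x) => H.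
rewrite -ler_pdivrMl ?divr_gt0// invf_div.
by apply: le_trans H; lra.
Qed.

Lemma le_gauss s t x : s <= t -> gauss t x <= gauss s x.
Proof. by move=> st; rewrite ler_expR ler_wpM2r ?dotp_ge0// lerN2. Qed.

Lemma affine_gauss_le t x : 0 < t ->
  (1 + dotp x x) * gauss t x <= (1 + 2 / t) * gauss (t / 2) x.
Proof.
move=> t0; rewrite mulrDl [leRHS]mulrDl !mul1r lerD ?dotp_gauss_le//.
by apply: le_gauss; lra.
Qed.

(** The bound does not depend on [w]: it provides the integrable majorant of the derivatives along a
    whole unit segment, at the price of a wider gaussian. *)
Lemma affine_gauss_shift_le t x w : 0 < t -> dotp w w <= 1 ->
  (1 + dotp (x + w) (x + w)) * gauss t (x + w) <=
  (1 + 2 / t) * expR (t / 2) * gauss (t / 4) x.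
Proof.
move=> t0 w1; apply: le_trans (affine_gauss_le _ t0) _.
have a0 : 0 <= 2 / t by rewrite divr_ge0// ltW.
rewrite -mulrA ler_wpM2l ?addr_ge0//.
have t20 : 0 <= t / 2 by rewrite divr_ge0// ltW.
apply: le_trans (gauss_shift_le _ _ t20) _.
have -> : t / 2 / 2 = t / 4 by field.
by rewrite ler_wpM2r ?gauss_ge0// ler_expR ler_piMr.
Qed.

Lemma is_derive_dotp_line x w (s : R) :
  is_derive s 1 (fun r : R => dotp (x + r *: w) (x + r *: w))
    (2 * dotp (x + s *: w) w).
Proof.
rewrite (_ : (fun r => _) =
    (fun r => dotp x x + r * (2 * dotp x w) + r ^+ 2 * dotp w w)); last first.
  apply/funext => r; rewrite !(dotpDl, dotpDr, dotpZl, dotpZr) (dotpC w x).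
  by ring.
apply: is_derive_eq.
rewrite !(dotpDl, dotpZl) /GRing.scale /=.
by ring.
Qed.

Lemma is_derive_gauss_line t x w (s : R) :
  is_derive s 1 (fun r : R => gauss t (x + r *: w))
    (- 2 * t * dotp (x + s *: w) w * gauss t (x + s *: w)).
Proof.
have H := is_derive_dotp_line x w s.
have H2 : is_derive s 1 (fun r : R => - t * dotp (x + r *: w) (x + r *: w)) (-
    t * (2 * dotp (x + s *: w) w)).
  by apply: is_derive_eq; rewrite /GRing.scale /=; ring.
have := @is_derive1_comp R expR _ s _ _ (is_derive_expR _) H2.
move=> H3; apply: is_derive_eq; rewrite /gauss; ring.
Qed.

Lemma integrable_gauss_le t (f : 'rV[R]_n -> R) (C : R) : 0 < t ->
  measurable_fun setT f -> (forall x, `|f x| <= C * gauss t x) ->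
  (lebesgue_rV n).-integrable setT (fun x => (f x)%:E).
Proof.
move=> t0 mf fC; apply: (@le_integrable _ _ _ _ _ measurableT _ (fun x => C%:E
    * (gauss t x)%:E)%E).
- exact/measurable_EFinP.
- move=> x _; rewrite -EFinM lee_fin; apply: le_trans (fC x) _; exact: ler_norm.
- by apply: integrableZl => //; exact: integrable_gauss.
Qed.

End gaussian_bounds.

(** * Gaussians as elements of [H^1] *)

Section gaussian_H1.
Context {R : realType} {n : nat}.
Implicit Types (x y w s : 'rV[R]_n) (t : R).

Lemma norm_dotp_unit_le x s : dotp s s = 1 -> `|dotp x s| <= 1 + dotp x x.
Proof.
move=> s1; have := dotp_unit_sqr_le x s1; rewrite -[in X in X -> _]real_normK
    ?num_real//.
move: `|dotp x s| => a; have := sqr_ge0 (a - 1); nra.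
Qed.

Lemma measurable_dotpr s : measurable_fun setT (fun x => dotp x s).
Proof.
apply: (measurable_dotp (F := idfun) (G := cst s)).
  exact: measurable_id.
exact: measurable_cst.
Qed.

Lemma integrable_sqr_gauss t s : 0 < t -> dotp s s = 1 ->
  (lebesgue_rV n).-integrable setT (fun x => (dotp x s ^+ 2 * gauss t x)%:E).
Proof.
move=> t0 s1; apply: (@integrable_gauss_le _ _ (t / 2) _ (2 / t)).
- by rewrite divr_gt0.
- apply: measurable_funM; last exact: measurable_gauss.
  by apply: measurable_funX; exact: measurable_dotpr.
move=> x; rewrite ger0_norm; last first.
  by apply: mulr_ge0; [exact: sqr_ge0|exact: gauss_ge0].
apply: le_trans (dotp_gauss_le _ t0).
by rewrite ler_wpM2r ?gauss_ge0// dotp_unit_sqr_le.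
Qed.

Lemma integral_sqr_gauss t s : 0 < t -> dotp s s = 1 ->
  (\int[lebesgue_rV n]_x (dotp x s ^+ 2 * gauss t x)%:E =
   ((2 * t)^-1)%:E * \int[lebesgue_rV n]_x (gauss t x)%:E)%E.
Proof.
move=> t0 s1; have t40 : 0 < t / 4 by rewrite divr_gt0.
have ig := integrable_gauss n t0.
have isg := integrable_sqr_gauss t0 s1.
(* The derivative of [f] along the unit vector [s] is [df]; the vanishing of its integral is the
   claim multiplied by [2 t]. *)
pose f x := dotp x s * gauss t x.
pose df x := gauss t x - 2 * t * (dotp x s ^+ 2 * gauss t x).
have mf : measurable_fun setT f.
  by apply: measurable_funM; [exact: measurable_dotpr|exact: measurable_gauss].
have mdf : measurable_fun setT df.
  apply: measurable_funB; first exact: measurable_gauss.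
  apply: measurable_funM => //.
  apply: measurable_funM; last exact: measurable_gauss.
  by apply: measurable_funX; exact: measurable_dotpr.
have intf : (lebesgue_rV n).-integrable setT (fun x => (f x)%:E).
  apply: (@integrable_gauss_le _ _ (t / 2) _ (1 + 2 / t)) => //.
    by rewrite divr_gt0.
  move=> x; apply: le_trans (affine_gauss_le _ t0).
  rewrite /f normrM (ger0_norm (gauss_ge0 _ _)) ler_wpM2r ?gauss_ge0//.
  exact: norm_dotp_unit_le.
(* The first factor comes from [|1 - 2t(y.s)^2| <= (1 + 2t)(1 + |y|^2)], the rest from
   [affine_gauss_shift_le]. *)
pose C : R := (1 + 2 * t) * ((1 + 2 / t) * expR (t / 2)).
have [|||intdf df0] := @integral_directional_derivative R n s f df
    (fun x => C%:E * (gauss (t / 4) x)%:E)%E intf mdf.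
- move=> x r; rewrite /f.
  have H1 : is_derive r 1 (fun r : R => dotp (x + r *: s) s) 1.
    rewrite (_ : (fun r => _) = (fun r => dotp x s + r)); last first.
      by apply/funext => r'; rewrite dotpDl dotpZl s1 mulr1.
    by apply: is_derive_eq; ring.
  have H2 := is_derive_gauss_line t x s r.
  apply: is_derive_eq; rewrite /df /GRing.scale /=; ring.
- by apply: integrableZl => //; exact: integrable_gauss.
- move=> x r /andP[r0 r1]; rewrite -EFinM lee_fin.
  have rs1 : dotp (r *: s) (r *: s) <= 1.
    by rewrite dotpZl dotpZr s1 mulr1 mulr_ile1.
  have t20 : 0 <= 1 + 2 * t by rewrite addr_ge0// mulr_ge0// ltW.
  rewrite /C -[leRHS]mulrA.
  apply: le_trans (ler_wpM2l t20 (affine_gauss_shift_le x t0 rs1)).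
  set y := x + r *: s; rewrite [leRHS]mulrA.
  have -> : df y = (1 - 2 * t * dotp y s ^+ 2) * gauss t y.
    by rewrite /df; ring.
  rewrite normrM (ger0_norm (gauss_ge0 _ _)) ler_wpM2r ?gauss_ge0//.
  apply: le_trans (ler_normB _ _) _; rewrite normr1 ger0_norm; last first.
    by rewrite mulr_ge0 ?sqr_ge0// mulr_ge0// ltW.
  have := dotp_unit_sqr_le y s1; have := dotp_ge0 y; have := sqr_ge0 (dotp y s).
  move: (dotp y s ^+ 2) (dotp y y) => a b a0 b0 ab.
  nra.
have E : (\int[lebesgue_rV n]_x (dotp x s ^+ 2 * gauss t x)%:E =
    \int[lebesgue_rV n]_x (((2 * t)^-1)%:E * ((gauss t x)%:E - (df x)%:E)))%E.
  apply: eq_integral => x _; rewrite -EFinB -EFinM /df; congr EFin.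
  by field; rewrite gt_eqF.
rewrite E (integralZl measurableT (integrableB measurableT ig intdf)).
rewrite (integralB measurableT ig intdf) df0 sube0.
by [].
Qed.

Lemma Lfun2_sqr (f : 'rV[R]_n -> R) : measurable_fun setT f ->
  (\int[lebesgue_rV n]_x (f x ^+ 2)%:E < +oo)%E ->
  f \in Lfun (lebesgue_rV n) 2%:E.
Proof.
move=> mf foo; rewrite inE; apply/andP; split; rewrite inE//=.
rewrite /finite_norm unlock; apply: poweR_lty.
rewrite [ltLHS](_ : _ = \int[lebesgue_rV n]_x (f x ^+ 2)%:E)%E//.
apply: eq_integral => x _; rewrite /= powR_mulrn//.
by rewrite real_normK ?num_real.
Qed.

Lemma bounded_of_compact_support (f : 'rV[R]_n -> R) (K : set 'rV[R]_n) :
  continuous f -> compact K -> (forall x, ~ K x -> f x = 0) ->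
  exists2 A, 0 <= A & forall x, `|f x| <= A.
Proof.
move=> cf cK f0.
have [A [_ fA]] : bounded_set (f @` K).
  by apply: compact_bounded; apply: continuous_compact => //; exact:
      continuous_subspaceT.
exists (`|A| + 1); first by rewrite addr_ge0.
move=> x; have [Kx|Kx] := pselect (K x); last by rewrite f0// normr0 addr_ge0.
apply: (fA (`|A| + 1)); first by rewrite (le_lt_trans (ler_norm A))// ltrDl.
by exists x.
Qed.

Lemma partial_eq0_off_support (i : 'I_n) (f : 'rV[R]_n -> R) x :
  ~ closure [set x | f x != 0] x -> partial i f x = 0.
Proof.
move=> fx; rewrite /partial.
have oC : open (~` closure [set x | f x != 0]) by apply: closed_openC; exact:
    closed_closure.
rewrite (near_eq_derive (g := cst 0)).
  exact: derive_cst.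
near=> y.
have : (~` closure [set x | f x != 0]) y by near: y; exact: open_nbhs_nbhs.
by move=> fy; apply: contrapT => /eqP fy0; apply: fy; exact: subset_closure.
Unshelve. all: end_near.
Qed.

Lemma is_derive_line (f : 'rV[R]_n -> R) x w (s : R) :
  differentiable f (x + s *: w) ->
  is_derive s 1 (fun r : R => f (x + r *: w)) ('D_w f (x + s *: w)).
Proof.
move=> df.
have E : (fun h : R => h^-1 *: (f (x + (h *: 1 + s) *: w) - f (x + s *: w))) =
         (fun h : R => h^-1 *: (f (h *: w + (x + s *: w)) - f (x + s *: w))).
  apply/funext => h; congr (_ *: (f _ - _)).
  by rewrite [h *: 1]mulr1 scalerDl addrCA.
apply: DeriveDef; first by rewrite /derivable E; exact: diff_derivable.
by rewrite /derive E.
Qed.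

Lemma measurable_coord i : measurable_fun setT (fun x : 'rV[R]_n => x ord0 i).
Proof. by apply: continuous_rV_measurable => x; exact: coord_continuous. Qed.

Lemma norm_coord_le (x : 'rV[R]_n) i : `|x ord0 i| <= 1 + dotp x x.
Proof. by rewrite -dotp_delta norm_dotp_unit_le// dotp_delta_delta. Qed.

Definition gauss_grad t x : 'rV[R]_n := (- t * gauss (t / 2) x) *: x.

Lemma gauss_grad_le t x i : 0 < t ->
  `|gauss_grad t x ord0 i| <= t * ((1 + dotp x x) * gauss (t / 2) x).
Proof.
move=> t0; rewrite mxE !normrM normrN (gtr0_norm t0) (ger0_norm (gauss_ge0 _ _)).
rewrite -mulrA [gauss _ _ * _]mulrC ler_wpM2l ?(ltW t0)//.
by rewrite ler_wpM2r ?gauss_ge0// norm_coord_le.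
Qed.

Lemma measurable_gauss_grad t i :
  measurable_fun setT (fun x => gauss_grad t x ord0 i).
Proof.
under eq_fun do rewrite mxE.
apply: measurable_funM; last exact: measurable_coord.
by apply: measurable_funM => //; exact: measurable_gauss.
Qed.

Lemma gauss_distributional_gradient t : 0 < t ->
  distributional_gradient (gauss (t / 2)) (gauss_grad t).
Proof.
move=> t0 phi [sphi cphi] i.
have t20 : 0 < t / 2 by rewrite divr_gt0.
have t40 : 0 < t / 2 / 2 by rewrite divr_gt0.
pose e : 'rV[R]_n := delta_mx ord0 i.
have dphi x : differentiable phi x := sphi [::] x.
have dpphi x : differentiable (partial i phi) x := sphi [:: i] x.
have cphi0 : continuous phi by move=> x; exact: differentiable_continuous.
have cpphi : continuous (partial i phi) by move=> x; exact:
    differentiable_continuous.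
have mphi := continuous_rV_measurable cphi0.
have mpphi := continuous_rV_measurable cpphi.
have mg := @measurable_gauss R n (t / 2).
have [|A A0 phiA] := bounded_of_compact_support cphi0 cphi.
  move=> x xK; apply: contrapT => /eqP fx; apply: xK; exact: subset_closure.
have [|B B0 phiB] := bounded_of_compact_support cpphi cphi.
  exact: partial_eq0_off_support.
(* By the product rule, [df1 + df2] is the derivative of [f] along [e]; that its integral is 0 is
   the duality relation sought. *)
pose f x := gauss (t / 2) x * phi x.
pose df1 x := gauss_grad t x ord0 i * phi x.
pose df2 x := gauss (t / 2) x * partial i phi x.
have df1_le x : `|df1 x| <= t * A * ((1 + dotp x x) * gauss (t / 2) x).
  rewrite /df1 normrM mulrAC ler_pM//.
  exact: gauss_grad_le.
have df2_le x : `|df2 x| <= B * gauss (t / 2) x.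
  by rewrite /df2 normrM (ger0_norm (gauss_ge0 _ _)) mulrC ler_wpM2r ?gauss_ge0.
have mdf1 : measurable_fun setT df1.
  by apply: measurable_funM => //; exact: measurable_gauss_grad.
have mdf2 : measurable_fun setT df2 by exact: measurable_funM.
have idf1 : (lebesgue_rV n).-integrable setT (fun x => (df1 x)%:E).
  apply: (@integrable_gauss_le _ _ (t / 2 / 2) _ (t * A * (1 + 2 / (t / 2))))
      => // x.
  apply: le_trans (df1_le x) _; rewrite -[leRHS]mulrA ler_wpM2l//.
    by rewrite mulr_ge0// ltW.
  exact: affine_gauss_le.
have idf2 : (lebesgue_rV n).-integrable setT (fun x => (df2 x)%:E).
  exact: (@integrable_gauss_le _ _ (t / 2) _ B).
have iF : (lebesgue_rV n).-integrable setT (fun x => (f x)%:E).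
  apply: (@integrable_gauss_le _ _ (t / 2) _ A) => //; first exact: measurable_funM.
  by move=> x; rewrite /f normrM (ger0_norm (gauss_ge0 _ _)) mulrC ler_wpM2r
      ?gauss_ge0.
(* As [A] bounds [phi] and [B] its partial derivative, the integrand is at most
   [(t A + B)(1 + |y|^2) gauss (t/2) y], made uniform along the segment by
   [affine_gauss_shift_le]. *)
have [||||idf df0] := @integral_directional_derivative R n e f (fun x => df1 x
    + df2 x)
    (fun x => ((t * A + B) * ((1 + 2 / (t / 2)) * expR (t / 2 / 2)))%:E *
        (gauss (t / 2 / 4) x)%:E)%E iF.
- exact: measurable_funD.
- move=> x s.
  have H1 := is_derive_gauss_line (t / 2) x e s.
  have H2 := @is_derive_line phi x e s (dphi _).
  apply: is_derive_eq; rewrite /df1 /df2 mxE dotp_delta /partial /GRing.scale /=.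
  by field.
- by apply: integrableZl => //; apply: integrable_gauss; rewrite divr_gt0.
- move=> x s /andP[s0 s1]; rewrite -EFinM lee_fin.
  have se1 : dotp (s *: e) (s *: e) <= 1.
    by rewrite dotpZl dotpZr dotp_delta_delta mulr1 mulr_ile1.
  have tAB : 0 <= t * A + B by rewrite addr_ge0// mulr_ge0// ltW.
  rewrite -[leRHS]mulrA.
  apply: le_trans (ler_wpM2l tAB (affine_gauss_shift_le x t20 se1)).
  set y := x + s *: e.
  apply: le_trans (ler_normD _ _) _; rewrite [leRHS]mulrDl lerD//.
  apply: le_trans (df2_le y) _; rewrite ler_wpM2l// -[leLHS]mul1r.
  by rewrite ler_wpM2r ?gauss_ge0// lerDl dotp_ge0.
have : (\int[lebesgue_rV n]_x (df1 x)%:E + \int[lebesgue_rV n]_x (df2 x)%:E = 0)%E.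
  by rewrite -(integralD measurableT idf1 idf2).
(* Both integrals are finite, so the identity in the extended reals can be solved for one of
   them. *)
have := integrable_fin_num measurableT idf1; have := integrable_fin_num
    measurableT idf2.
rewrite /df1 /df2.
set I1 := (\int[_]_x _)%E; set I2 := (\int[_]_x _)%E.
case: I1 => // r1 _; case: I2 => // r2 _ [/eqP]; rewrite addrC addr_eq0 => /eqP ->.
by [].
Qed.

Lemma gauss_H1_gradient t : 0 < t ->
  H1_gradient (gauss (t / 2)) (gauss_grad t).
Proof.
move=> t0; have t20 : 0 < t / 2 by rewrite divr_gt0.
split; last exact: gauss_distributional_gradient.
  apply: Lfun2_sqr; first exact: measurable_gauss.
  under eq_integral do rewrite gauss_sqr.
  exact: (integrable_lty measurableT (integrable_gauss n t0)).
move=> i; apply: Lfun2_sqr; first exact: measurable_gauss_grad.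
have e1 := @dotp_delta_delta R n i.
have H := integrable_sqr_gauss t0 e1.
have -> : (\int[lebesgue_rV n]_x (gauss_grad t x ord0 i ^+ 2)%:E =
  \int[lebesgue_rV n]_x ((t ^+ 2)%:E * (dotp x (delta_mx ord0 i) ^+ 2 * gauss t
      x)%:E))%E.
  apply: eq_integral => x _; rewrite -EFinM; congr EFin.
  by rewrite mxE dotp_delta -(gauss_sqr t); ring.
exact: (integrable_lty measurableT (integrableZl _ _ H)).
Qed.

End gaussian_H1.

(** * Energies of gaussians *)

Section energy.
Context {R : realType} {n : nat}.
Local Open Scope ereal_scope.
Local Notation mu := (@lebesgue_rV R n).

Lemma measurable_rV_sub :
  measurable_fun setT (fun p : 'rV[R]_n * 'rV[R]_n => p.2 - p.1)%R.
Proof.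
exact: (measurable_rVD (@measurable_snd _ _ 'rV[R]_n 'rV[R]_n)
  (measurable_rVN (@measurable_fst _ _ 'rV[R]_n 'rV[R]_n))).
Qed.

(** By Tonelli, since the slice at each [x] is the translate of [N] by [x]. *)
Lemma off_diagonal_null (N : set 'rV[R]_n) : measurable N -> mu N = 0 ->
  measurable [set p : 'rV[R]_n * 'rV[R]_n | N (p.2 - p.1)%R] /\
  (mu \x mu) [set p | N (p.2 - p.1)%R] = 0.
Proof.
move=> mN N0; set M := [set p | _].
have mM : measurable M.
  by rewrite -[M]setTI; exact: measurable_rV_sub.
split => //.
have -> : (mu \x mu) M = \int[mu \x mu]_p (\1_M p)%:E.
  by rewrite integral_indic// setIT.
rewrite fubini_tonelli1//; last first.
  exact/measurable_EFinP.
rewrite /fubini_F integral0_eq// => x _.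
rewrite -(ge0_integral_translation x (f := fun y => (\1_M (x, y))%:E))//; last
    first.
  have mI : measurable_fun setT (\1_M : 'rV[R]_n * 'rV[R]_n -> R) by exact:
      measurable_indic.
  by apply/measurable_EFinP; exact: measurableT_comp mI (pair1_measurable x).
rewrite (_ : (fun _ => _) = (fun y => (\1_N y)%:E)).
  by rewrite integral_indic// setIT.
apply/funext => y; congr (_%:R%:E); apply: congr1; rewrite /M.
by apply/idP/idP => /set_mem/= H; apply/mem_set; move: H; rewrite /= addrK.
Qed.

Lemma nonlocal_energy_off_null (rho rho' u : 'rV[R]_n -> R) (N : set 'rV[R]_n) :
  measurable N -> mu N = 0 -> (forall x, 0 <= rho x)%R ->
  (forall x, 0 <= rho' x)%R -> (forall x, ~ N x -> rho x = rho' x) ->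
  nonlocal_energy rho u = nonlocal_energy rho' u.
Proof.
move=> mN N0 r0 r'0 rr'; have [mM M0] := off_diagonal_null mN N0.
rewrite /nonlocal_energy; congr (_ * _).
apply: (ge0_integral_eq_off_null mM M0) => p _; last by move=> /= /rr' ->.
  by rewrite lee_fin mulr_ge0// divr_ge0// sqr_ge0.
by rewrite lee_fin mulr_ge0// divr_ge0// sqr_ge0.
Qed.

Lemma measurable_div_enorm_sqr (rho : 'rV[R]_n -> R) :
  measurable_fun setT rho ->
  measurable_fun setT (fun z => rho z / enorm z ^+ 2)%R.
Proof.
move=> mrho; apply: measurable_funM => //.
have mn : measurable_fun setT (fun z : 'rV[R]_n => enorm z ^+ 2)%R.
  by apply: measurable_funX; apply: (measurable_enorm (F := idfun)); exact:
      measurable_id.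
(* The inverse and the power of exponent -1 both take the value 0 at 0, so they agree at the origin
   too. *)
rewrite (_ : (fun z => _) = (@powR R ^~ (-1)%R) \o (fun z : 'rV[R]_n => enorm z
    ^+ 2)%R).
  have mp := @measurable_powR R (-1)%R.
  exact: (measurableT_comp mp mn).
by apply/funext => z /=; rewrite powR_inv1// sqr_ge0.
Qed.

(** After the substitution [z = y - x] and an exchange of integrals, the integral in [x] is that of
    the squared increment; its factor 2 cancels the one half of the energy. *)
Lemma nonlocal_energy_gauss (rho : 'rV[R]_n -> R) (t : R) : (0 < t)%R ->
  measurable_fun setT rho -> (forall x, 0 <= rho x)%R ->
  nonlocal_energy rho (gauss (t / 2)) =
  \int[mu]_x (gauss t x)%:E *
  \int[mu]_z (rho z / enorm z ^+ 2 * (1 - expR (- (t / 4 * dotp z z))))%:E.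
Proof.
move=> t0 mrho rho0.
have [c c0 Ec] := integral_gauss n t0.
pose F (x z : 'rV[R]_n) := (rho z / enorm z ^+ 2 * (gauss (t / 2) (x + z)%R -
    gauss (t / 2) x) ^+ 2)%R.
have F0 x z : (0 <= F x z)%R.
  by rewrite mulr_ge0 ?sqr_ge0// divr_ge0// sqr_ge0.
have mk := measurable_div_enorm_sqr mrho.
have mg d (T : measurableType d) (f : T -> 'rV[R]_n) : measurable_fun setT f ->
    measurable_fun setT (fun x => gauss (t / 2) (f x)).
  by move=> mf; exact: measurableT_comp (@measurable_gauss R n (t / 2)) mf.
have mF : measurable_fun setT (fun p : 'rV[R]_n * 'rV[R]_n => (F p.1 p.2)%:E).
  apply/measurable_EFinP; apply: measurable_funM.
    exact: measurableT_comp mk measurable_snd.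
  apply: measurable_funX; apply: measurable_funB; apply: mg.
    by apply: measurable_rVD; [exact: measurable_fst|exact: measurable_snd].
  exact: measurable_fst.
rewrite /nonlocal_energy.
transitivity (2^-1%:E * \int[mu \x mu]_p (F p.1 (p.2 - p.1)%R)%:E).
  congr (_ * _); apply: eq_integral => -[x y] _ /=.
  rewrite /F addrCA subrr addr0 real_normK ?num_real//.
  by congr EFin; ring.
rewrite fubini_tonelli1; last 2 first.
- have ms : measurable_fun setT (fun p : 'rV[R]_n * 'rV[R]_n => (p.1, (p.2 -
    p.1)%R)).
    by apply/measurable_fun_pairP; split; [exact: measurable_fst|exact:
        measurable_rV_sub].
  exact: (measurableT_comp mF ms).
- by move=> p; rewrite lee_fin.
have mFx x : measurable_fun setT (fun z => (F x z)%:E).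
  exact: measurableT_comp mF (pair1_measurable x).
have -> : \int[mu]_x fubini_F mu (fun p => (F p.1 (p.2 - p.1)%R)%:E) x =
    \int[mu]_x \int[mu]_z (F x z)%:E.
  apply: eq_integral => x _; rewrite /fubini_F /=.
  rewrite -(ge0_integral_translation (- x)%R (mFx x))//.
  by move=> z; rewrite lee_fin.
rewrite (@fubini_tonelli _ _ _ _ _ mu mu (fun p => (F p.1 p.2)%:E))//; last first.
  by move=> p; rewrite lee_fin.
have -> : \int[mu]_z \int[mu]_x (F x z)%:E = \int[mu]_z ((2 * c)%:E *
   (rho z / enorm z ^+ 2 * (1 - expR (- (t / 4 * dotp z z))))%:E).
  apply: eq_integral => z _; rewrite /F.
  under eq_integral do rewrite EFinM.
  rewrite ge0_integralZl//; last 3 first.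
  - apply/measurable_EFinP; apply: measurable_funX; apply: measurable_funB;
      apply: mg.
      exact: measurable_rV_translation.
    exact: measurable_id.
  - by move=> x _; rewrite lee_fin sqr_ge0.
  - by rewrite lee_fin divr_ge0// sqr_ge0.
  rewrite integral_gauss_increment// Ec -!EFinM; congr EFin; ring.
rewrite Ec ge0_integralZl//; last 3 first.
- apply/measurable_EFinP; apply: measurable_funM => //.
  apply: measurable_funB => //; apply: measurableT_comp => //.
  apply: measurableT_comp => //; apply: measurable_funM => //.
  by apply: (measurable_dotp (F := idfun) (G := idfun)); exact: measurable_id.
- move=> z _; rewrite lee_fin mulr_ge0 ?divr_ge0 ?sqr_ge0//.
  by rewrite subr_ge0 -expR0 ler_expR oppr_le0 mulr_ge0 ?dotp_ge0// divr_ge0// ltW.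
- by rewrite lee_fin mulr_ge0// ltW.
by rewrite muleA -EFinM mulrA mulVf ?mul1r.
Qed.

End energy.

Section finite_measure_of.
Context {d} {T : measurableType d} {R : realType}.
Variables (mu : {measure set T -> \bar R}) (mufin : fin_num_fun mu).

(* The proof argument is a phantom that lets the finite measure instance be
   inferred. *)
Definition finite_measure_of of fin_num_fun mu : set T -> \bar R := mu.

HB.instance Definition _ := Measure.copy (finite_measure_of mufin) mu.

HB.instance Definition _ :=
  Measure_isFinite.Build _ _ _ (finite_measure_of mufin) mufin.

End finite_measure_of.

(** * The unit sphere and the limit energy *)

Section sphere_theory.
Context {R : realType} {n : nat}.

Lemma dotp_sphere (s : sphere R n) : dotp (set_val s) (set_val s) = 1.
Proof.
rewrite -enorm_sqr; case: s => x /= /set_mem/= ->.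
by rewrite expr1n.
Qed.

Lemma continuous_dotp_sqr m : continuous (fun x : 'rV[R]_m => dotp x x).
Proof.
move=> x; rewrite /dotp /continuous_at.
apply: cvg_big => [||i _]; [exact: add_continuous|exact: (nbhs_filter x)|].
by apply: cvgM; [exact: (nbhs_filter x)|exact: coord_continuous..].
Qed.

Lemma compact_unit_sphere : compact [set x : 'rV[R]_n.+1 | enorm x = 1].
Proof.
have E : [set x : 'rV[R]_n.+1 | enorm x = 1] =
    (fun x => dotp x x) @^-1` [set 1].
  apply/seteqP; split => x /=.
    by rewrite -enorm_sqr => ->; rewrite expr1n.
  by rewrite /enorm => ->; rewrite sqrtr1.
apply: (@subclosed_compact _ _ [set x : 'rV[R]_n.+1 | forall i : 'I_n.+1, `[(-1
    : R), 1]%classic (x ord0 i)]).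
- rewrite E; apply: closed_comp => [x _|]; first exact: continuous_dotp_sqr.
  by apply: accessible_closed_set1; apply: hausdorff_accessible; exact: Rhausdorff.
- by apply: (@rV_compact R n.+1 (fun=> `[(-1 : R), 1]%classic)) => i; exact:
    segment_compact.
rewrite E => x /= x1 i; rewrite in_itv/= -ler_norml.
rewrite -(@ler_pXn2r _ 2)// ?nnegrE// expr1n real_normK ?num_real//.
by rewrite -x1 -dotp_delta dotp_unit_sqr_le// dotp_delta_delta.
Qed.

(** The topology of [sphere] is initial for [set_val], so a cluster point of the image filter lifts.
    Compactness makes the Radon measure [lambda] finite. *)
Lemma compact_sphere : compact [set: sphere R n].
Proof.
move=> F PF _; pose F' := (set_val : sphere R n -> 'rV[R]_n.+1) @ F.
have PF' : ProperFilter F' by exact: fmap_proper_filter.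
have [|p [p1 clp]] := @compact_unit_sphere F' PF'.
  apply: (@filterS _ F _ setT) => [s _|]; last exact: filterT.
  by rewrite /= /enorm dotp_sphere sqrtr1.
exists (exist _ p (mem_set p1)); split => // A B FA.
case=> _ /= [] [W oW <- /= Wp WB].
have [|_ [[a Aa <-] Wa]] := clp (set_val @` A) W _ (open_nbhs_nbhs (conj oW Wp)).
  by apply: (@filterS _ F _ A) => [a Aa|//]; exists a.
by exists a; split => //; exact: WB.
Qed.

Lemma measurable_set_val :
  measurable_fun setT (set_val : sphere R n -> 'rV[R]_n.+1).
Proof.
apply: (@measurability _ _ _ _ _ _ (@open 'rV[R]_n.+1)) => //.
move=> _ [U oU <-]; rewrite setTI; apply: sub_sigma_algebra.
have /continuousP := @initial_continuous (sphere R n) 'rV[R]_n.+1 set_val.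
exact.
Qed.

Local Open Scope ereal_scope.

(** Integrating in [x] first gives [t^2 c_t / (2t)], the same value for every direction [s], so that
    [lambda] contributes only its total mass. *)
Lemma integral_gauss_grad_sphere (lambda : {measure set (sphere R n) -> \bar R})
    (t : R) : (0 < t)%R -> lambda setT < +oo ->
  \int[lebesgue_rV n.+1]_x \int[lambda]_s
    (`|dotp (gauss_grad t x) (set_val s)| ^+ 2)%:E =
  (t / 2)%:E * \int[lebesgue_rV n.+1]_x (gauss t x)%:E * lambda setT.
Proof.
move=> t0 loo.
have lfin : fin_num_fun lambda by exact: lty_fin_num_fun.
pose L : {finite_measure set (sphere R n) -> \bar R} :=
  finite_measure_of lfin.
pose H (p : 'rV[R]_n.+1 * sphere R n) :=
  ((t ^+ 2)%:E * (dotp p.1 (set_val p.2) ^+ 2 * gauss t p.1)%:E).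
have mp1 := @measurable_fst _ _ 'rV[R]_n.+1 (sphere R n).
have mp2 := @measurable_snd _ _ 'rV[R]_n.+1 (sphere R n).
have mH : measurable_fun setT H.
  rewrite /H; under eq_fun do rewrite -EFinM.
  apply/measurable_EFinP; apply: measurable_funM => //; apply: measurable_funM.
    apply: measurable_funX; apply: (measurable_dotp mp1).
    exact: (measurableT_comp measurable_set_val mp2).
  exact: (measurableT_comp (@measurable_gauss R _ t) mp1).
have H0 p : 0 <= H p.
  by rewrite mule_ge0// lee_fin ?sqr_ge0// mulr_ge0 ?sqr_ge0 ?gauss_ge0.
transitivity (\int[lebesgue_rV n.+1]_x \int[L]_s H (x, s)).
  apply: eq_integral => x _; apply: eq_integral => s _.
  rewrite /H /= -EFinM; congr EFin; rewrite real_normK ?num_real//.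
  by rewrite dotpZl -(gauss_sqr t); ring.
rewrite (fubini_tonelli H mH H0).
have [c c0 Ec] := integral_gauss n.+1 t0.
transitivity (\int[L]_s (t / 2 * c)%:E).
  apply: eq_integral => s _; rewrite /H /=.
  rewrite (integralZl measurableT (integrable_sqr_gauss t0 (dotp_sphere s))).
  rewrite integral_sqr_gauss// ?dotp_sphere// Ec -!EFinM; congr EFin; field.
  by rewrite gt_eqF.
by rewrite integral_cst//= Ec EFinM.
Qed.

End sphere_theory.

(** * Concentration at the origin *)

Section elementary_bounds.
Context {R : realType}.
Implicit Types (p s : R).

(** This rearranges [(1 + p) exp(-p) <= 1]. All later lower bounds on [1 - exp(-p)] with [p >= 0]
    come from it. *)
Lemma one_sub_expRN_ge p : 0 <= p -> p <= (1 + p) * (1 - expR (- p)).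
Proof.
move=> p0; rewrite expRN; have := expR_ge1Dx p => H.
have e0 := expR_gt0 p; have : (expR p)^-1 * (1 + p) <= 1.
  by rewrite ler_pdivrMl// mulr1.
by lra.
Qed.

Lemma one_sub_expRN_ge0 p : 0 <= p -> 0 <= 1 - expR (- p).
Proof. by move=> p0; rewrite subr_ge0 -expR0 ler_expR oppr_le0. Qed.

(** Near the origin, the error made in replacing [1 - exp(-p)] by [p] is thus negligible relative to
    [1 - exp(-p)] itself. *)
Lemma expRN_taylor1_le p : 0 <= p -> p - 1 + expR (- p) <= p * (1 - expR (- p)).
Proof. by move=> p0; have := one_sub_expRN_ge p0; lra. Qed.

(** The right-hand side has a double root at 1: it factors as [(1 - s)^2 (3 + 2s + s^2)]. *)
Lemma quartic_gap_ge s : 0 <= s -> 3 * (1 - s) ^+ 2 <= 4 * (1 - s) - (1 - s ^+ 4).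
Proof.
move=> s0; rewrite -subr_ge0.
have -> : 4 * (1 - s) - (1 - s ^+ 4) - 3 * (1 - s) ^+ 2 =
  (1 - s) ^+ 2 * (2 * s + s ^+ 2) by ring.
by rewrite mulr_ge0 ?sqr_ge0// addr_ge0 ?sqr_ge0// mulr_ge0.
Qed.

Lemma min1_le_one_sub_expRN p : 0 <= p -> (if p < 1 then p else 1) <= 2 * (1 -
    expR (- p)).
Proof.
move=> p0; have := one_sub_expRN_ge p0; have := one_sub_expRN_ge0 p0.
case: ifPn => [p1|]; last rewrite -leNgt => p1; nra.
Qed.

End elementary_bounds.

Section Cc_bounds.
Context {R : realType} {n : nat}.
Implicit Types z : 'rV[R]_n.

Lemma nbhs0_dotp (P : set 'rV[R]_n) : nbhs (0 : 'rV[R]_n) P ->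
  exists2 d : R, 0 < d & forall z, dotp z z < d -> P z.
Proof.
move=> /nbhs_ballP[e /= e0 eP]; exists (e ^+ 2); first exact: exprn_gt0.
move=> z ze; apply: eP; split => // i j; rewrite (ord1 i) /ball/= mxE sub0r normrN.
rewrite -(@ltr_pXn2r _ 2)// ?nnegrE ?(ltW e0)// real_normK ?num_real//.
apply: le_lt_trans ze.
by rewrite -dotp_delta dotp_unit_sqr_le// dotp_delta_delta.
Qed.

(* Multiplied by [rho_k(z) / |z|^2], the two terms on the right are the densities
   of [e * Phi_k(1)] and of the vanishing [C * (4 * Phi_k(1/4) - Phi_k(1))]. *)
Lemma Cc_gauss_bound (f : 'rV[R]_n -> R) (e : R) : Cc f -> 0 < e ->
  exists2 C : R, 0 <= C & forall z, let q := dotp z z in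
    `|q * f z - 4 * f 0 * (1 - expR (- (1 / 4 * q)))| <=
    e * (1 - expR (- (1 / 4 * q))) +
    C * (4 * (1 - expR (- (1 / 4 / 4 * q))) - (1 - expR (- (1 / 4 * q)))).
Proof.
move=> [cf kf] e0.
have f0K z : ~ closure [set x | f x != 0] z -> f z = 0.
  by move=> zK; apply: contrapT => /eqP fz; apply: zK; exact: subset_closure.
have [||B B0 fB] := @bounded_of_compact_support R n (fun z => dotp z z * f z) _
    _ kf.
- by move=> z; apply: cvgM; [exact: (nbhs_filter z)|exact:
    continuous_dotp_sqr|exact: cf].
- by move=> z /f0K ->; rewrite mulr0.
have [d1 d10 d1f] : exists2 d : R, 0 < d & forall z, dotp z z < d -> `|f z - f
    0| < e / 16.
  apply: nbhs0_dotp; have /cvgrPdist_lt/(_ (e / 16)) := cf 0.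
  rewrite divr_gt0// => /(_ isT); apply: filterS => z.
  by rewrite distrC.
have F0 := normr_ge0 (f 0); set F := `|f 0| in F0.
(* For [q < d], the first threshold gives [|f z - f 0| < e/16], the second [q <= 8 (1 - exp(-q/4))],
   the third [q F <= e/2]; each of the two error terms is then at most [e/2] times
   [1 - exp(-q/4)]. *)
pose d := Num.min d1 (Num.min 4 (e / (2 * (F + 1)))).
have F1 : 0 < 2 * (F + 1) by lra.
have d0 : 0 < d by rewrite !lt_min d10 divr_gt0//= andbT; lra.
pose s0 := expR (- (1 / 4 / 4 * d)).
have s01 : s0 < 1 by rewrite -expR0 ltr_expR oppr_lt0 mulr_gt0.
have gap0 : 0 < 3 * (1 - s0) ^+ 2 by rewrite mulr_gt0// exprn_gt0// subr_gt0.
(* For [q >= d] the left-hand side is at most [B + 4 F], while the gap is at least [3 (1 - s0)^2];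
   with this quotient the second term suffices alone. *)
exists ((B + 4 * F) / (3 * (1 - s0) ^+ 2)).
  by rewrite divr_ge0 ?(ltW gap0)// addr_ge0// mulr_ge0.
move=> z; move: (dotp_ge0 z); set q := dotp z z => q0; cbv zeta.
have p0 : 0 <= 1 / 4 * q by rewrite mulr_ge0.
have E0 := one_sub_expRN_ge0 p0.
set s := expR (- (1 / 4 / 4 * q)).
have s0' : 0 <= s by exact: expR_ge0.
have s4 : expR (- (1 / 4 * q)) = s ^+ 4.
  by rewrite -expRM_natl; congr expR; field.
have gapE := quartic_gap_ge s0'; rewrite -s4 in gapE.
have gap : 0 <= 4 * (1 - s) - (1 - expR (- (1 / 4 * q))).
  by apply: le_trans gapE; rewrite mulr_ge0// sqr_ge0.
have C0 : 0 <= (B + 4 * F) / (3 * (1 - s0) ^+ 2).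
  by rewrite divr_ge0 ?(ltW gap0)// addr_ge0// mulr_ge0.
have [qd|dq] := ltP q d.
  apply: (@le_trans _ _ (e * (1 - expR (- (1 / 4 * q))))); last first.
    by rewrite lerDl mulr_ge0.
  have := expRN_taylor1_le p0; have := one_sub_expRN_ge p0.
  move: qd; rewrite !lt_min => /and3P[qd1 q4 qF].
  have := d1f _ qd1.
  have {}qF : q * F <= e / 2.
    move: qF; rewrite ltr_pdivlMr//.
    by lra.
  have T0 : 0 <= 1 / 4 * q - 1 + expR (- (1 / 4 * q)).
    by have := expR_ge1Dx (- (1 / 4 * q)); lra.
  move: E0 T0; set x := expR (- (1 / 4 * q)) => E0 T0 fz q1 q2.
  (* Continuity of [f] at 0 controls the first term, the Taylor remainder controls the second. *)
  have -> : q * f z - 4 * f 0 * (1 - x) =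
      q * (f z - f 0) + 4 * f 0 * (1 / 4 * q - 1 + x) by field.
  apply: le_trans (ler_normD _ _) _.
  rewrite !normrM (ger0_norm q0) (ger0_norm T0) (ger0_norm (_ : 0 <= 4))// -/F.
  have h1 : q * `|f z - f 0| <= q * (e / 16) by rewrite ler_wpM2l// ltW.
  have h2 : q <= 8 * (1 - x) by nra.
  have h3 : q * (e / 16) <= 8 * (1 - x) * (e / 16).
    by rewrite ler_wpM2r// divr_ge0// ltW.
  have h4 : 4 * F * (1 / 4 * q - 1 + x) <= 4 * F * (1 / 4 * q * (1 - x)).
    by rewrite ler_wpM2l// mulr_ge0.
  have h5 : q * F * (1 - x) <= e / 2 * (1 - x) by rewrite ler_wpM2r.
  by lra.
apply: (@le_trans _ _ (B + 4 * F)).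
  apply: le_trans (ler_normB _ _) _; apply: lerD; first exact: fB.
  rewrite !normrM (ger0_norm (_ : 0 <= 4))// -/F (ger0_norm E0).
  by rewrite ler_piMr ?mulr_ge0// gerBl expR_ge0.
apply: ler_wpDl; first by rewrite mulr_ge0// ltW.
apply: (@le_trans _ _ ((B + 4 * F) / (3 * (1 - s0) ^+ 2) * (3 * (1 - s0) ^+ 2))).
  by rewrite divfK// gt_eqF.
rewrite ler_wpM2l//; apply: le_trans gapE; rewrite ler_wpM2l//.
have ss0 : s <= s0 by rewrite ler_expR lerN2 ler_wpM2l.
by rewrite ler_pXn2r// ?nnegrE ?subr_ge0; lra.
Qed.

End Cc_bounds.

Section concentration.
Context {R : realType} {n : nat}.
Local Notation mu := (@lebesgue_rV R n).
Implicit Types (rho : 'rV[R]_n -> R) (t : R) (z : 'rV[R]_n).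

Definition gauss_density rho t z : R :=
  rho z / enorm z ^+ 2 * (1 - expR (- (t / 4 * dotp z z))).

Lemma gauss_density_ge0 rho t z : 0 < t -> (forall x, 0 <= rho x) ->
  0 <= gauss_density rho t z.
Proof.
move=> t0 r0; rewrite mulr_ge0 ?divr_ge0 ?sqr_ge0// one_sub_expRN_ge0//.
by rewrite mulr_ge0 ?dotp_ge0// divr_ge0// ltW.
Qed.

Lemma measurable_gauss_density rho t : measurable_fun setT rho ->
  measurable_fun setT (gauss_density rho t).
Proof.
move=> mrho; apply: measurable_funM; first exact: measurable_div_enorm_sqr.
apply: measurable_funB => //; apply: measurableT_comp => //.
apply: measurableT_comp => //; apply: measurable_funM => //.
by apply: (measurable_dotp (F := idfun) (G := idfun)); exact: measurable_id.
Qed.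

Lemma measurable_eball (r : R) : measurable (@eball R n r).
Proof.
rewrite (_ : eball r = (fun x => enorm x) @^-1` `]-oo, r[%classic).
  rewrite -[X in measurable X]setTI.
  have me : measurable_fun setT (fun x : 'rV[R]_n => enorm x).
    by apply: (measurable_enorm (F := idfun)); exact: measurable_id.
  by apply: me => //; exact: measurable_itv.
by apply/seteqP; split => x /=; rewrite in_itv.
Qed.

(** With [p = t|z|^2/4] this is [p <= (1 + p)(1 - exp(-p))]. It makes [rho] integrable on bounded
    sets as soon as the density is integrable. At [z = 0] the right-hand side is 0, whence
    [rho 0 = 0]. *)
Lemma rho_le_gauss_density rho t z : 0 < t -> (forall x, 0 <= rho x) ->
  rho 0 = 0 -> rho z <= (4 / t + dotp z z) * gauss_density rho t z.
Proof.
move=> t0 r0 r00; have [->|z0] := eqVneq z 0.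
  rewrite {1}r00 mulr_ge0 ?gauss_density_ge0// addr_ge0 ?dotp_ge0//.
  by rewrite divr_ge0// ltW.
rewrite /gauss_density enorm_sqr; have := dotp_ge0 z.
rewrite le_eqVlt eq_sym dotp_eq0 (negbTE z0)/=.
move: (dotp z z) => q q0.
have p0 : 0 <= t / 4 * q by rewrite !mulr_ge0// ltW.
have := one_sub_expRN_ge p0; set E := expR _ => H.
have -> : (4 / t + q) * (rho z / q * (1 - E)) =
   rho z * ((4 / (t * q)) * ((1 + t / 4 * q) * (1 - E))).
  by field; rewrite !gt_eqF.
rewrite -{1}[rho z]mulr1 ler_wpM2l//.
apply: (@le_trans _ _ (4 / (t * q) * (t / 4 * q))); last first.
  by rewrite ler_wpM2l// divr_ge0// mulr_ge0// ltW.
by rewrite le_eqVlt; apply/orP; left; apply/eqP; field; rewrite !gt_eqF.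
Qed.

Local Open Scope ereal_scope.

(** The parameter [4/r^2] makes the exponent [p = |z|^2/r^2]. Inside and outside the ball, the
    integrand on the left is [r^2 rho(z)/|z|^2] times [min(1, p)]. *)
Lemma levy_mass_le rho (r : R) : (0 < r)%R -> measurable_fun setT rho ->
  (forall x, 0 <= rho x)%R -> rho 0%R = 0%R ->
  \int[mu]_(z in eball r) (rho z)%:E +
  (r ^+ 2)%:E * \int[mu]_(z in ~` eball r) (rho z / enorm z ^+ 2)%:E <=
  (2 * r ^+ 2)%:E * \int[mu]_z (gauss_density rho (4 / r ^+ 2) z)%:E.
Proof.
move=> r0 mrho rho0 rho00.
have r20 : (0 < r ^+ 2)%R by rewrite exprn_gt0.
have t0 : (0 < 4 / r ^+ 2)%R by rewrite divr_gt0.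
have mB := measurable_eball r.
have mg := measurable_gauss_density (4 / r ^+ 2) mrho.
have g0 z := gauss_density_ge0 z t0 rho0.
have c0 : (0 <= 2 * r ^+ 2)%R by apply: mulr_ge0 => //; exact: ltW.
have key z : ((if enorm z < r then rho z else r ^+ 2 * (rho z / enorm z ^+ 2)) <=
    2 * r ^+ 2 * gauss_density rho (4 / r ^+ 2) z)%R.
  have [->|z0] := eqVneq z 0%R.
    by rewrite rho00 mul0r mulr0 if_same; apply: mulr_ge0.
  have q0 : (0 < enorm z ^+ 2)%R by rewrite enorm_sqr lt_def dotp_eq0 z0 dotp_ge0.
  have k0 : (0 <= rho z / enorm z ^+ 2)%R by rewrite divr_ge0// ltW.
  set p := (enorm z ^+ 2 / r ^+ 2)%R.
  have p0 : (0 <= p)%R by rewrite divr_ge0// ltW.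
  have -> : gauss_density rho (4 / r ^+ 2) z =
      (rho z / enorm z ^+ 2 * (1 - expR (- p)))%R.
    rewrite /gauss_density -enorm_sqr; congr (_ * (1 - expR (- _)))%R.
    by rewrite /p; field; rewrite gt_eqF.
  have -> : (enorm z < r)%R = (p < 1)%R.
    by rewrite ltr_pdivrMr// mul1r ltr_pXn2r// nnegrE ?enorm_ge0// ltW.
  have := min1_le_one_sub_expRN p0; set E := expR _ => H.
  rewrite (_ : 2 * r ^+ 2 * _ = r ^+ 2 * (rho z / enorm z ^+ 2) * (2 * (1 -
      E)))%R; last by ring.
  have k1 : (0 <= r ^+ 2 * (rho z / enorm z ^+ 2))%R by rewrite mulr_ge0// ltW.
  apply: le_trans (ler_wpM2l k1 H); case: ifP => _; last by rewrite mulr1.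
  have zn0 : enorm z != 0%R by apply: contraTneq q0 => ->; rewrite expr0n ltxx.
  rewrite le_eqVlt; apply/orP; left; apply/eqP; rewrite /p; field.
  by rewrite zn0 gt_eqF.
have mG : measurable_fun setT (fun z => (2 * r ^+ 2 * gauss_density rho (4 / r
    ^+ 2) z)%:E).
  by apply/measurable_EFinP; exact: measurable_funM.
have G0 z : 0 <= (2 * r ^+ 2 * gauss_density rho (4 / r ^+ 2) z)%:E.
  by rewrite lee_fin mulr_ge0.
have mk := measurable_div_enorm_sqr mrho.
have k0 z : 0 <= (rho z / enorm z ^+ 2)%:E by rewrite lee_fin divr_ge0// sqr_ge0.
have -> : (r ^+ 2)%:E * \int[mu]_(z in ~` eball r) (rho z / enorm z ^+ 2)%:E =
    \int[mu]_(z in ~` eball r) (r ^+ 2 * (rho z / enorm z ^+ 2))%:E.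
  under [RHS]eq_integral do rewrite EFinM.
  rewrite ge0_integralZl//; first exact: measurableC.
    exact/measurable_EFinP/measurable_funTS.
  by rewrite lee_fin ltW.
have -> : (2 * r ^+ 2)%:E * \int[mu]_z (gauss_density rho (4 / r ^+ 2) z)%:E =
    \int[mu]_z (2 * r ^+ 2 * gauss_density rho (4 / r ^+ 2) z)%:E.
  under [RHS]eq_integral do rewrite EFinM.
  rewrite ge0_integralZl//; first exact/measurable_EFinP.
  by move=> z _; rewrite lee_fin.
rewrite -[X in _ <= \int[_]_(_ in X) _](setUv (eball r)) ge0_integral_setU//;
    first last.
- exact/disj_setPCl.
- by rewrite setUv.
- exact: measurableC.
apply: leeD; apply: ge0_le_integral => //.
- by move=> z _; rewrite lee_fin.
- exact/measurable_EFinP/measurable_funTS.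
- exact: measurable_funTS.
- by move=> z zr; rewrite lee_fin; have := key z; rewrite ifT.
- exact: measurableC.
- by move=> z _; rewrite EFinM mule_ge0// lee_fin ltW.
- apply/measurable_EFinP/measurable_funTS; exact: measurable_funM.
- exact: measurable_funTS.
- move=> z /negP zr; rewrite lee_fin; have := key z.
  by rewrite (negbTE zr).
Qed.

Lemma limn_esup_le_lim (u v : nat -> \bar R) (l : \bar R) :
  (forall k, u k <= v k) -> v k @[k --> \oo] --> l -> limn_esup u <= l.
Proof.
move=> uv vl; have <- : limn_esup v = l.
  by rewrite is_cvg_limn_esupE ?(cvg_lim _ vl)//; exact: cvgP vl.
apply: le_ereal_inf_tmp => _ [V FV <-].
apply: (@le_trans _ _ (ereal_sup (u @` V))).
  by apply: ereal_inf_lbound; exists V.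
apply: ge_ereal_sup => _ [k Vk <-]; apply: (le_trans (uv k)).
by apply: ereal_sup_ubound; exists k.
Qed.

End concentration.

(** * Passage to the limit against functions of [C_c] *)

Section concentration_limit.
Context {R : realType} {n : nat}.
Local Notation mu := (@lebesgue_rV R n).
Variables (r : nat -> 'rV[R]_n -> R) (K : R).
Hypothesis mr : forall k, measurable_fun setT (r k).
Hypothesis r_ge0 : forall k z, 0 <= r k z.
Hypothesis r0 : forall k, r k 0 = 0.
Hypothesis Phi_cvg : forall t : R, 0 < t ->
  (\int[mu]_z (gauss_density (r k) t z)%:E)%E @[k --> \oo] --> (t * K)%:E.

(** Convergence to a real number forces the integrals to be finite from some index on. *)
Lemma near_integrable_gauss_density t : 0 < t ->
  \forall k \near \oo, mu.-integrable setT (fun z => (gauss_density (r k) t z)%:E).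
Proof.
move=> t0; have /fine_cvgP[fin _] := Phi_cvg t0.
apply: filterS fin => k fink; apply/integrableP; split.
  by apply/measurable_EFinP; exact: measurable_gauss_density.
under eq_integral do rewrite gee0_abs ?lee_fin ?gauss_density_ge0//.
by rewrite ltey_eq fink.
Qed.

Lemma integrable_of_gauss_density k (A : set 'rV[R]_n) (Q : R) :
  measurable A -> A `<=` [set z | dotp z z <= Q] ->
  mu.-integrable setT (fun z => (gauss_density (r k) 1 z)%:E) ->
  mu.-integrable A (fun z => (r k z)%:E).
Proof.
move=> mA AQ ik.
apply: (@le_integrable _ _ _ _ _ mA _ (fun z => (4 + Q)%:E * (gauss_density (r
    k) 1 z)%:E)%E).
- exact/measurable_EFinP/measurable_funTS.
- move=> z /= /AQ/= zQ; rewrite lee_fin (ger0_norm (r_ge0 k z)).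
  apply: le_trans (ler_norm _).
  apply: le_trans (rho_le_gauss_density z ltr01 (r_ge0 k) (r0 k)) _.
  by rewrite divr1 ler_wpM2r ?gauss_density_ge0// lerD2l.
- apply: integrableZl => //.
  by apply: (integrableS _ _ _ ik).
Qed.

(** Integrating [Cc_gauss_bound] against [r k z / |z|^2] compares the integral of [r k * f] with
    [4 f(0) Phi_k(1)], which tends to [4 K f(0)]. *)
Lemma Cc_integral_cvg (f : 'rV[R]_n -> R) : Cc f ->
  (\int[mu]_z (r k z * f z)%:E)%E @[k --> \oo] --> (4 * K * f 0)%:E.
Proof.
move=> Ccf; have [cf _] := Ccf; have mf := continuous_rV_measurable cf.
pose y k := fine (\int[mu]_z (gauss_density (r k) 1 z)%:E)%E.
pose w k := fine (\int[mu]_z (gauss_density (r k) (1 / 4) z)%:E)%E.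
have q0 : 0 < 1 / 4 :> R by rewrite divr_gt0.
have yK : y k @[k --> \oo] --> K.
  have H := fine_cvg (Phi_cvg ltr01); rewrite mul1r in H; exact: H.
have wK : w k @[k --> \oo] --> 1 / 4 * K by exact: fine_cvg (Phi_cvg q0).
have bound e : 0 < e -> exists2 C, 0 <= C & \forall k \near \oo,
    (\int[mu]_z (r k z * f z)%:E)%E \is a fin_num /\
    `|fine (\int[mu]_z (r k z * f z)%:E)%E - 4 * f 0 * y k| <=
      e * y k + C * (4 * w k - y k).
  move=> e0; have [C C0 HC] := Cc_gauss_bound Ccf e0.
  exists C => //.
  near=> k.
  have iy : mu.-integrable setT (fun z => (gauss_density (r k) 1 z)%:E).
    by near: k; exact: near_integrable_gauss_density.
  have iw : mu.-integrable setT (fun z => (gauss_density (r k) (1 / 4) z)%:E).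
    by near: k; exact: near_integrable_gauss_density.
  pose g z := e * gauss_density (r k) 1 z +
    C * (4 * gauss_density (r k) (1 / 4) z - gauss_density (r k) 1 z).
  have key z : `|r k z * f z - 4 * f 0 * gauss_density (r k) 1 z| <= g z.
    have k0 : 0 <= r k z / dotp z z by rewrite divr_ge0// dotp_ge0.
    (* At [z = 0] this relies on the normalisation [r k 0 = 0]. *)
    have -> : r k z = r k z / dotp z z * dotp z z.
      have [->|z0] := eqVneq z 0; first by rewrite r0 !mul0r.
      by rewrite divfK// dotp_eq0.
    have := ler_wpM2l k0 (HC z); rewrite -[X in X * `|_|](ger0_norm k0) -normrM.
    rewrite /g /gauss_density enorm_sqr; set p := r k z / dotp z z.
    by congr (`|_| <= _); ring.
  have iyE : (\int[mu]_z (gauss_density (r k) 1 z)%:E)%E = (y k)%:E.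
    by rewrite fineK// integrable_fin_num.
  have iwE : (\int[mu]_z (gauss_density (r k) (1 / 4) z)%:E)%E = (w k)%:E.
    by rewrite fineK// integrable_fin_num.
  have iey := integrableZl measurableT e iy.
  have i4w := integrableZl measurableT 4 iw.
  have iwy := integrableB measurableT i4w iy.
  have iCwy := integrableZl measurableT C iwy.
  have ig : mu.-integrable setT (fun z => (g z)%:E).
    exact: (integrableD measurableT iey iCwy).
  have igE : (\int[mu]_z (g z)%:E)%E = (e * y k + C * (4 * w k - y k))%:E.
    have := integralD measurableT iey iCwy.
    rewrite (integralZl measurableT iy) (integralZl measurableT iwy).
    rewrite (integralB measurableT i4w iy) (integralZl measurableT iw).
    by rewrite iyE iwE.
  pose D z := r k z * f z - 4 * f 0 * gauss_density (r k) 1 z.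
  have mD : measurable_fun setT D.
    apply: measurable_funB; first exact: measurable_funM.
    by apply: measurable_funM => //; exact: measurable_gauss_density.
  have iD : mu.-integrable setT (fun z => (D z)%:E).
    apply: (@le_integrable _ _ _ _ _ measurableT _ _ _ _ ig).
      exact/measurable_EFinP.
    by move=> z _; rewrite lee_fin; apply: le_trans (key z) (ler_norm _).
  have ify := integrableZl measurableT (4 * f 0) iy.
  have iXE : (\int[mu]_z (r k z * f z)%:E =
      \int[mu]_z (D z)%:E + (4 * f 0 * y k)%:E)%E.
    have := integralD measurableT iD ify.
    rewrite (integralZl measurableT iy) iyE -EFinM => <-.
    by apply: eq_integral => z _; rewrite -EFinM -EFinD /D subrK.
  have fD := integrable_fin_num measurableT iD.
  rewrite iXE fin_numD fD; split => //.
  rewrite fineD// addrK -lee_fin -igE.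
  have -> : (`|fine (\int[mu]_z (D z)%:E)%E|%:E = `|\int[mu]_z (D z)%:E|)%E.
    by rewrite -{2}(fineK fD).
  apply: le_trans (le_abse_integral _ measurableT _) _; first
      exact/measurable_EFinP.
  apply: ge0_le_integral => //.
  - by apply: measurableT_comp => //; exact/measurable_EFinP.
  - exact: measurable_int ig.
  - by move=> z _; rewrite lee_fin; exact: key.
have K0 : 0 <= K.
  rewrite -(cvg_lim (@Rhausdorff R) yK); apply: limr_ge; first exact: cvgP yK.
  apply: nearW => k.
  apply: fine_ge0; apply: integral_ge0 => z _.
  by rewrite lee_fin gauss_density_ge0.
apply/fine_cvgP; split.
  by have [C _] := bound 1 ltr01; apply: filterS => k [].
apply/cvgrPdist_lt => e e0.
(* Ensures [e' K < e], including when [K = 0]. *)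
pose e' := e / (K + 1).
have K10 : 0 < K + 1 by lra.
have e'0 : 0 < e' by rewrite divr_gt0.
have [C C0 HC] := bound e' e'0.
(* The constant [C] depends on [e'] and may be huge, but its factor tends to [4 (K/4) - K = 0]. *)
have lim : e' * y k + C * (4 * w k - y k) + `|4 * f 0 * (y k - K)| @[k --> \oo] -->
    e' * K + C * (4 * (1 / 4 * K) - K) + `|4 * f 0 * (K - K)|.
  apply: cvgD.
    apply: cvgD; apply: cvgMr => //.
    by apply: cvgB => //; exact: cvgMr.
  by apply: cvg_norm; apply: cvgMr; apply: cvgB => //; exact: cvg_cst.
have lim_lt : e' * K + C * (4 * (1 / 4 * K) - K) + `|4 * f 0 * (K - K)| < e.
  rewrite subrr mulr0 normr0 addr0 (_ : 4 * (1 / 4 * K) - K = 0); last by field.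
  by rewrite mulr0 addr0 /e' mulrAC ltr_pdivrMr// ltr_pM2l// ltrDl.
near=> k.
have [_ Hk] : (\int[mu]_z (r k z * f z)%:E)%E \is a fin_num /\
    `|fine (\int[mu]_z (r k z * f z)%:E)%E - 4 * f 0 * y k| <=
      e' * y k + C * (4 * w k - y k) by near: k.
have lt_e : e' * y k + C * (4 * w k - y k) + `|4 * f 0 * (y k - K)| < e.
  by near: k; exact: (cvgr_lt _ lim).
rewrite /= distrC; apply: le_lt_trans lt_e.
set X := fine _ in Hk *.
rewrite (_ : X - _ = (X - 4 * f 0 * y k) + 4 * f 0 * (y k - K)); last by ring.
by apply: le_trans (ler_normD _ _) _; rewrite lerD2r.
Unshelve. all: end_near.
Qed.

End concentration_limit.

(** Resetting the value at the origin costs only the null set [[set 0]]. Null set and function are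
    packed in a pair so that [choice] selects both for all [k]. *)
Lemma lebesgue_measurable_fun_borel (R : realType) n (f : 'rV[R]_n.+1 -> R) :
  lebesgue_measurable_fun f -> (forall z, 0 <= f z) ->
  exists Ng : set 'rV[R]_n.+1 * ('rV[R]_n.+1 -> R),
    [/\ measurable Ng.1, lebesgue_rV n.+1 Ng.1 = 0%E, measurable_fun setT Ng.2,
        (forall z, 0 <= Ng.2 z) & Ng.2 0 = 0 /\ forall z, ~ Ng.1 z -> f z = Ng.2 z].
Proof.
move=> mf f0; have [N [mN N0 mg]] := lebesgue_measurable_fun_off_null mf.
set g := (fun x => _) in mg.
have m0 := @measurable_rV_set1 R n.+1 0.
have mC : measurable_fun setT (\1_(~` [set (0 : 'rV[R]_n.+1)]) : _ -> R).
  by apply: measurable_indic; exact: measurableC.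
have g0 z : 0 <= g z by rewrite /g; case: ifP.
exists (N `|` [set 0], fun z => g z * \1_(~` [set (0 : 'rV[R]_n.+1)]) z); split
    => /=.
- exact: measurableU.
- by rewrite null_set_setU//; exact: lebesgue_rV_set1.
- exact: measurable_funM.
- by move=> z; rewrite mulr_ge0.
split; first by rewrite indicE memNset ?mulr0//= => /(_ erefl).
move=> z /not_orP[Nz z0].
by rewrite /g indicE (memNset Nz) (mem_set (z0 : (~` [set 0]) z)) mulr1.
Qed.

Lemma compact_dotp_bounded (R : realType) n (A : set 'rV[R]_n) : compact A ->
  exists2 Q : R, 0 <= Q & A `<=` [set z | dotp z z <= Q].
Proof.
move=> cA; have [M [_ HM]] : bounded_set ((fun z => dotp z z) @` A).
  apply: compact_bounded; apply: continuous_compact => //.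
  by apply: continuous_subspaceT; exact: continuous_dotp_sqr.
exists (`|M| + 1); first by rewrite addr_ge0.
move=> z Az /=; apply: le_trans (ler_norm _) _.
by apply: (HM (`|M| + 1)); [rewrite (le_lt_trans (ler_norm M))// ltrDl|exists z].
Qed.

Theorem theorem1p1 (R : realType) (n : nat)
    (rho : R -> 'rV[R]_n.+1 -> R)
    (rho_ge0 : forall e, 0 < e < 1 -> forall z, 0 <= rho e z)
    (rho_measurable : forall e, 0 < e < 1 -> lebesgue_measurable_fun (rho e))
    (lambda : {measure set (sphere R n) -> \bar R})
    (lambda_radon : radon_measure lambda)
    (eps : nat -> R)
    (eps01 : forall k, 0 < eps k < 1)
    (eps_cvg : eps k @[k --> \oo] --> (0 : R))
    (energy_cvg : forall u g, H1_gradient u g ->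
      nonlocal_energy (rho (eps k)) u @[k --> \oo] -->
        (\int[lebesgue_rV n.+1]_x \int[lambda]_s
          (`|dotp (g x) (set_val s)| ^+ 2)%:E)%E) :
  (exists2 M : R, 0 <= M & forall r : R, 0 < r ->
    (limn_esup (fun k =>
      \int[lebesgue_rV n.+1]_(z in eball r) (rho (eps k) z)%:E +
      (r ^+ 2)%:E * \int[lebesgue_rV n.+1]_(z in ~` eball r)
        (rho (eps k) z / enorm z ^+ 2)%:E) <= M%:E)%E) /\
  (exists nu : nat -> {measure set 'rV[R]_n.+1 -> \bar R},
    (\forall k \near \oo, radon_measure (nu k) /\
      forall f, Cc f ->
        (\int[nu k]_z (f z)%:E =
         \int[lebesgue_rV n.+1]_z (rho (eps k) z * f z)%:E)%E) /\
    exists alpha : {nonneg R},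
      locally_weak_star_cvg nu (mscale alpha (\d_(0 : 'rV[R]_n.+1)))).
Proof.
have Ng_ k := lebesgue_measurable_fun_borel (rho_measurable _ (eps01 k))
    (rho_ge0 _ (eps01 k)).
have [Ng HNg] := choice Ng_.
pose N k := (Ng k).1; pose r k := (Ng k).2.
have mN k : measurable (N k) by have [] := HNg k.
have N0 k : lebesgue_rV n.+1 (N k) = 0%E by have [] := HNg k.
have mr k : measurable_fun setT (r k) by have [] := HNg k.
have r_ge0 k z : 0 <= r k z by have [_ _ _ H _] := HNg k; exact: H.
have r0 k : r k 0 = 0 by have [_ _ _ _ [H _]] := HNg k; exact: H.
have rhor k z : ~ N k z -> rho (eps k) z = r k z by have [_ _ _ _ [_ H]] := HNg
    k; exact: H.
have rho0 k z := rho_ge0 (eps k) (eps01 k) z.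
have loo : (lambda setT < +oo)%E by apply: lambda_radon; exact: compact_sphere.
have lfin : lambda setT \is a fin_num by rewrite ge0_fin_numE.
pose K := fine (lambda setT) / 2.
have K0 : 0 <= K by rewrite divr_ge0// fine_ge0.
have Phi_cvg (t : R) : 0 < t ->
    (\int[lebesgue_rV n.+1]_z (gauss_density (r k) t z)%:E)%E @[k --> \oo] -->
        (t * K)%:E.
  move=> t0; have [c c0 Ec] := integral_gauss n.+1 t0.
  have := energy_cvg _ _ (gauss_H1_gradient t0).
  rewrite integral_gauss_grad_sphere// Ec => H.
  (* Dividing the energies by [c = c_t] isolates [Phi_k(t)]; the factor [t / 2] of the limit energy
     is the origin of the one half in [K]. *)
  have -> : (t * K)%:E = (c^-1%:E * ((t / 2)%:E * c%:E * lambda setT))%E.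
    rewrite -(fineK lfin) -!EFinM; congr EFin; rewrite /K; field.
    by rewrite gt_eqF.
  rewrite (_ : (fun k => _) =
    (fun k => c^-1%:E * nonlocal_energy (rho (eps k)) (gauss (t / 2)))%E).
    exact: cvgeZl.
  apply/funext => k.
  rewrite (nonlocal_energy_off_null _ (mN k) (N0 k) (rho0 k) (r_ge0 k) (rhor k)).
  by rewrite nonlocal_energy_gauss// Ec muleA -EFinM mulVf ?gt_eqF// mul1e.
split.
  (* This is [2 s^2] times the limit [(4/s^2) K] of [Phi_k(4/s^2)]: the radius cancels. *)
  exists (8 * K); first by rewrite mulr_ge0.
  move=> s s0; have s20 : 0 < 4 / s ^+ 2 by rewrite divr_gt0// exprn_gt0.
  apply: (limn_esup_le_lim (v := fun k => ((2 * s ^+ 2)%:E *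
      \int[lebesgue_rV n.+1]_z (gauss_density (r k) (4 / s ^+ 2) z)%:E)%E)).
    move=> k; apply: le_trans (levy_mass_le s0 (mr k) (r_ge0 k) (r0 k)).
    rewrite le_eqVlt; apply/orP; left; apply/eqP.
    congr (_ + _ * _)%E; apply: (ge0_integral_eq_off_null (mN k) (N0 k)).
    - by move=> z _; rewrite lee_fin.
    - by move=> z _; rewrite lee_fin.
    - by move=> z _ /rhor ->.
    - by move=> z _; rewrite lee_fin divr_ge0// sqr_ge0.
    - by move=> z _; rewrite lee_fin divr_ge0// sqr_ge0.
    - by move=> z _ /rhor ->.
  have -> : (8 * K)%:E = ((2 * s ^+ 2)%:E * (4 / s ^+ 2 * K)%:E)%E.
    by rewrite -EFinM; congr EFin; field; rewrite gt_eqF.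
  by apply: cvgeZl => //; exact: Phi_cvg.
(* The measures are built from the Borel versions, for every [k]; they are shown to be Radon for
   large [k], once the density of [Phi_k(1)] is integrable. *)
have nu_ k := density_measure (lebesgue_rV n.+1) (mr k) (r_ge0 k).
pose nu k : {measure set 'rV[R]_n.+1 -> \bar R} := sval (cid2 (nu_ k)).
have nuE k A : measurable A ->
    nu k A = (\int[lebesgue_rV n.+1]_(x in A) (r k x)%:E)%E.
  by rewrite /nu; case: cid2 => m /= H _; exact: H.
have int_nu k f : Cc f ->
    (\int[nu k]_z (f z)%:E = \int[lebesgue_rV n.+1]_z (r k z * f z)%:E)%E.
  move=> [cf _]; have mf := continuous_rV_measurable cf.
  by rewrite /nu; case: cid2 => m /= _ H; exact: H.
exists nu; split.
  have := near_integrable_gauss_density mr r_ge0 Phi_cvg ltr01.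
  apply: filterS => k ik; split.
    move=> A cA; have [Q Q0 AQ] := compact_dotp_bounded cA.
    have mA : measurable A.
      have oA : open (~` A).
        by apply: closed_openC; apply: compact_closed cA; exact: norm_hausdorff.
      by rewrite -(setCK A); apply: measurableC; exact: open_rV_measurable oA.
    rewrite nuE//; apply: (integrable_lty mA).
    exact: integrable_of_gauss_density mA AQ ik.
  move=> f Cf; rewrite int_nu//.
  apply: (integral_eq_off_null (mN k) (N0 k)) => z /rhor ->.
  by [].
(* The limit mass [4 K] is twice the total mass of [lambda]. *)
have a0 : 0 <= 4 * K by rewrite mulr_ge0.
exists (NngNum a0) => f Cf.
have [cf _] := Cf; have mf := continuous_rV_measurable cf.
rewrite (_ : (fun k => _) = (fun k => \int[lebesgue_rV n.+1]_z (r k z * f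
    z)%:E)%E); last first.
  by apply/funext => k; rewrite int_nu.
have -> : (\int[mscale (NngNum a0) \d_((0 : 'rV[R]_n.+1)%R)]_z (f z)%:E)%E = (4
    * K * f 0)%:E.
  have mEf : measurable_fun setT (EFin \o f) by exact/measurable_EFinP.
  have mp := measurable_funepos mEf; have mn := measurable_funeneg mEf.
  rewrite integralE !ge0_integral_mscale// !integral_dirac// diracT !mul1e.
  rewrite funeposE funenegE /= -!EFin_max -!EFinM -EFinB -mulrBr.
  congr (_ * _)%:E; rewrite !maxEle oppr_le0; case: ifP => f1; case: ifP => f2; lra.
exact: Cc_integral_cvg.
Qed.
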